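(* Let $f$ be a non-constant entire function. Then $$Z(f')=\bigcup_{\phi\in{\rm Aut}(f)-\{{\rm id}\}}\{w\in\mathbb{C}\,|\,\phi(w)=w\}=:{\rm Fix}({\rm Aut}(f)),$$ where $Z(f')$ is the zero set of $f'$.
   Context: An automorphic function of $f$ is a (generally multivalued) analytic function $\phi$, or a branch of one, satisfying $f(\phi(z))=f(z)$, i.e. a branch of $f^{-1}\circ f$; ${\rm Aut}(f)$ is the group (under composition) of all of them, with identity ${\rm id}(z)=z$. A point $w$ is a fixed point of $\phi\in{\rm Aut}(f)-\{{\rm id}\}$ if a branch of $f^{-1}\circ f$ different from the identity branch takes the value $w$ at $w$ (as its value or limit value at $w$). *)

(* Defs.v *)
From Stdlib Require Import Reals.
From Coquelicot Require Import Coquelicot.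

Definition C_ex_derive (f : C -> C) (z : C) : Prop :=
  @ex_derive C_AbsRing C_NormedModule f z.
Definition C_is_derive (f : C -> C) (z l : C) : Prop :=
  @is_derive C_AbsRing C_NormedModule f z l.

Definition entire (f : C -> C) : Prop := forall z, C_ex_derive f z.

Definition nonconstant (f : C -> C) : Prop := exists z1 z2, f z1 <> f z2.

Definition connected_set (U : C -> Prop) : Prop :=
  forall A B : C -> Prop, open A -> open B ->
    (forall z, U z -> A z \/ B z) ->
    (forall z, U z -> A z -> B z -> False) ->
    (exists z, U z /\ A z) -> (exists z, U z /\ B z) -> False.

Definition domain (U : C -> Prop) : Prop :=
  open U /\ connected_set U /\ exists z, U z.

(* phi restricted to the domain U is a (single-valued analytic) branch of
   f^{-1} o f, i.e. an element of Aut(f) on U: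
   phi is holomorphic on U and f (phi z) = f z on U. *)
Definition aut_branch (f : C -> C) (U : C -> Prop) (phi : C -> C) : Prop :=
  domain U /\ forall z, U z -> C_ex_derive phi z /\ f (phi z) = f z.

Definition non_identity_on (U : C -> Prop) (phi : C -> C) : Prop :=
  exists z, U z /\ phi z <> z.

(* phi on U takes the value w at w, as its value (w in U, phi w = w) or as
   limit value (w in the closure of U and phi z -> w as z -> w in U). *)
Definition takes_value_at (U : C -> Prop) (phi : C -> C) (w v : C) : Prop :=
  (forall eps : posreal, exists z, U z /\ ball w eps z) /\
  filterlim phi (within U (locally w)) (locally v).

Definition FixAut (f : C -> C) (w : C) : Prop :=
  exists (U : C -> Prop) (phi : C -> C),
    aut_branch f U phi /\ non_identity_on U phi /\ takes_value_at U phi w w.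

(* Main.v *)
Require Import Defs.
From Stdlib Require Import Reals Lra Lia Classical ClassicalEpsilon.
From Coquelicot Require Import Coquelicot.
Open Scope R_scope.

(** Near a point w a non-constant entire function has the form
    f (w + u) = f w + c u^k g u with c <> 0, k >= 1, g entire and g 0 = 1.
    Substituting u = z s turns f (w + u) = f (w + z) into s^k g (z s) = g z,
    which for small z is a small perturbation of s^k = 1. If f' w = 0 then
    k >= 2, and solving for s near a root of unity a <> 1 by contraction gives
    the branch z |-> z s(z), holomorphic on a whole disc, fixing w with
    derivative a. Conversely, if f' w <> 0 then f is injective near w, so a
    branch with limit value w at w is the identity on a nonempty open set; the
    same blow-up shows that a branch fixing a point is the identity near it or
    has no other fixed point near it, so by connectedness it is the identity
    everywhere. The normal form comes from Cauchy's integral formula, proved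
    for complex differentiable functions through Goursat's theorem. *)

(** Goursat's theorem gives primitives of entire functions, but not yet continuity of their
    derivatives, while the homotopy argument behind Cauchy's formula differentiates under the
    integral sign and relies on a continuous derivative. The formula is therefore shown for a
    primitive F of f, whose derivative f is continuous, and carried over to f by differentiating it
    and integrating by parts. Three consequences matter: strict differentiability, a first-order
    estimate in which two points move independently; division of f z - f 0 by z within the entire
    functions; and a bound for f inside a circle by its values on the circle. The last one shows
    that repeated division stops unless f is constant. Strictness is what makes the blown-up
    equation contracting and f injective near a noncritical point. At a critical point f has no
    local inverse, but in the quotient s = u / z the equation is nondegenerate uniformly in z,
    because all roots of s^k = 1 are simple. *)

(** * Estimates for the complex modulus *)

Lemma Cmod_minus_comm (x y : C) : Cmod (x - y) = Cmod (y - x).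
Proof. rewrite <- Cmod_opp. f_equal. ring. Qed.

Lemma Cmod_triangle_minus (x y : C) : Cmod (x - y) <= Cmod x + Cmod y.
Proof. rewrite <- (Cmod_opp y). apply Cmod_triangle. Qed.

Lemma Cmod_triangle_rev (x y : C) : Cmod x - Cmod y <= Cmod (x - y).
Proof.
  assert (H := Cmod_triangle (x - y) y).
  replace (x - y + y)%C with x in H by ring. lra.
Qed.

Lemma Cmod_minus_trans (x y z : C) : Cmod (x - z) <= Cmod (x - y) + Cmod (y - z).
Proof.
  replace (x - z)%C with ((x - y) + (y - z))%C by ring. apply Cmod_triangle.
Qed.

Lemma Cmod_minus_neq_0 (x y : C) : x <> y -> 0 < Cmod (x - y).
Proof.
  intros H. apply Cmod_gt_0. intros E. apply H.
  replace x with ((x - y) + y)%C by ring. rewrite E. ring.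
Qed.

Lemma Cmod_minus_diag (x : C) : Cmod (x - x) = 0.
Proof. replace (x - x)%C with (RtoC 0) by ring. apply Cmod_0. Qed.

Lemma Cmod_le_Re_Im (z : C) : Cmod z <= Rabs (Re z) + Rabs (Im z).
Proof.
  assert (H : z = (RtoC (Re z) + Ci * RtoC (Im z))%C).
  { destruct z as [a b]. unfold Cplus, Cmult, Ci, RtoC; simpl. f_equal; ring. }
  rewrite H at 1. eapply Rle_trans; [apply Cmod_triangle|].
  rewrite Cmod_mult, Cmod_Ci, !Cmod_R. lra.
Qed.

Lemma im_le_Cmod (z : C) : Rabs (Im z) <= Cmod z.
Proof. eapply Rle_trans; [|apply Rmax_Cmod]. apply Rmax_r. Qed.

Lemma Cmod_small_eq_0 (z : C) : (forall e, 0 < e -> Cmod z <= e) -> z = 0.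
Proof.
  intros H. apply Cmod_eq_0. destruct (Rle_lt_or_eq_dec 0 (Cmod z) (Cmod_ge_0 z)) as [h|h]; auto.
  specialize (H (Cmod z / 2)). lra.
Qed.

Lemma RtoC_neq_0 (x : R) : x <> 0 -> RtoC x <> RtoC 0.
Proof. intros h E. apply h. now apply RtoC_inj. Qed.

(** * Limits of complex-valued functions *)

(** The filter is arbitrary so that one set of limit rules serves real parameters ([locally t]) and
    complex ones ([cnbhd z]). *)
Definition clim {T : Type} (F : (T -> Prop) -> Prop) (f : T -> C) (l : C) : Prop :=
  forall e, 0 < e -> F (fun y => Cmod (f y - l) < e).

(** Neighbourhoods are given by discs for [Cmod], whereas [locally] on C uses squares;
    [cnbhd_locally] identifies the two filters. *)
Definition cnbhd (z : C) (P : C -> Prop) : Prop :=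
  exists d, 0 < d /\ forall y, Cmod (y - z) < d -> P y.

Global Instance cnbhd_filter z : ProperFilter (cnbhd z).
Proof.
  constructor.
  - intros P [d [hd H]]. exists z. apply H. rewrite Cmod_minus_diag; lra.
  - constructor.
    + exists 1. split; [lra|auto].
    + intros P Q [d [hd H]] [d' [hd' H']]. exists (Rmin d d'). split; [now apply Rmin_pos|].
      intros y hy. split; [apply H|apply H']; eapply Rlt_le_trans; eauto; [apply Rmin_l|apply Rmin_r].
    + intros P Q H [d [hd H']]. exists d; auto.
Qed.

Lemma cnbhd_locally (z : C) (P : C -> Prop) : cnbhd z P <-> locally z P.
Proof.
  split.
  - intros [d [hd H]].
    assert (h2 : 0 < d / 2) by lra.
    exists (mkposreal _ h2). intros y [h1 h3]. apply H.
    change (Rabs (Re y - Re z) < d / 2) in h1. change (Rabs (Im y - Im z) < d / 2) in h3.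
    eapply Rle_lt_trans; [apply Cmod_le_Re_Im|].
    unfold Cminus, Cplus, Copp, Re, Im in *; simpl. unfold Rminus in *. lra.
  - intros [d H]. exists d. split; [apply cond_pos|].
    intros y hy. apply H. split.
    + eapply Rle_lt_trans; [apply (re_le_Cmod (y - z))|exact hy].
    + eapply Rle_lt_trans; [apply (im_le_Cmod (y - z))|exact hy].
Qed.

Section Limits.
Context {T : Type} (F : (T -> Prop) -> Prop) {FF : Filter F}.

Lemma clim_const (c : C) : clim F (fun _ => c) c.
Proof. intros e he. apply filter_forall. intros _. rewrite Cmod_minus_diag. exact he. Qed.

Lemma clim_val (f : T -> C) (l m : C) : l = m -> clim F f l -> clim F f m.
Proof. now intros ->. Qed.

Lemma clim_ext_loc (f g : T -> C) l : F (fun y => f y = g y) -> clim F f l -> clim F g l.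
Proof.
  intros H Hf e he. generalize (filter_and _ _ H (Hf e he)). apply filter_imp.
  intros y [E h]. rewrite <- E. exact h.
Qed.

Lemma clim_plus (f g : T -> C) a b : clim F f a -> clim F g b -> clim F (fun y => f y + g y)%C (a + b)%C.
Proof.
  intros Hf Hg e he. assert (h : 0 < e / 2) by lra.
  generalize (filter_and _ _ (Hf _ h) (Hg _ h)). apply filter_imp. intros y [h1 h2].
  replace (f y + g y - (a + b))%C with ((f y - a) + (g y - b))%C by ring.
  eapply Rle_lt_trans; [apply Cmod_triangle|]. lra.
Qed.

Lemma clim_mult (f g : T -> C) a b : clim F f a -> clim F g b -> clim F (fun y => f y * g y)%C (a * b)%C.
Proof.
  intros Hf Hg e he.
  (* If both factors err by at most d <= 1, the product errs by at most d (1 + |a| + |b|). *)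
  set (M := 1 + Cmod a + Cmod b).
  assert (hM : 1 <= M) by (unfold M; pose proof (Cmod_ge_0 a); pose proof (Cmod_ge_0 b); lra).
  set (d := Rmin 1 (e / (2 * M))).
  assert (hd : 0 < d).
  { apply Rmin_pos; [lra|]. apply Rdiv_lt_0_compat; lra. }
  assert (hd1 : d <= 1) by apply Rmin_l.
  assert (hd2 : 2 * (d * M) <= e).
  { assert (h := Rmin_r 1 (e / (2 * M))). fold d in h.
    apply Rle_trans with (2 * (e / (2 * M) * M)). 2:{ right. field. lra. }
    apply Rmult_le_compat_l; [lra|]. apply Rmult_le_compat_r; lra. }
  generalize (filter_and _ _ (Hf _ hd) (Hg _ hd)). apply filter_imp. intros y [h1 h2].
  replace (f y * g y - a * b)%C with ((f y - a) * (g y - b) + (f y - a) * b + a * (g y - b))%C by ring.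
  eapply Rle_lt_trans; [apply Cmod_triangle|].
  eapply Rle_lt_trans; [apply Rplus_le_compat_r, Cmod_triangle|].
  rewrite !Cmod_mult.
  pose proof (Cmod_ge_0 a); pose proof (Cmod_ge_0 b);
  pose proof (Cmod_ge_0 (f y - a)); pose proof (Cmod_ge_0 (g y - b)).
  assert (Cmod (f y - a) * Cmod (g y - b) <= d * 1) by (apply Rmult_le_compat; lra).
  assert (Cmod (f y - a) * Cmod b <= d * Cmod b) by (apply Rmult_le_compat_r; lra).
  assert (Cmod a * Cmod (g y - b) <= Cmod a * d) by (apply Rmult_le_compat_l; lra).
  assert (0 < d * M) by (apply Rmult_lt_0_compat; lra).
  replace (d * M) with (d + d * Cmod a + d * Cmod b) in * by (unfold M; ring). lra.
Qed.

Lemma clim_opp (f : T -> C) a : clim F f a -> clim F (fun y => - f y)%C (- a)%C.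
Proof.
  intros Hf e he. generalize (Hf e he). apply filter_imp. intros y h.
  replace (- f y - - a)%C with (- (f y - a))%C by ring. now rewrite Cmod_opp.
Qed.

Lemma clim_minus (f g : T -> C) a b : clim F f a -> clim F g b -> clim F (fun y => f y - g y)%C (a - b)%C.
Proof. intros Hf Hg. apply clim_plus; [exact Hf|]. now apply clim_opp. Qed.

Lemma clim_inv (f : T -> C) (a : C) : a <> 0 -> clim F f a -> clim F (fun y => / f y)%C (/ a)%C.
Proof.
  intros ha Hf e he.
  assert (hm : 0 < Cmod a) by (apply Cmod_gt_0; assumption).
  set (d := Rmin (Cmod a / 2) (e * (Cmod a * Cmod a) / 4)).
  assert (hd : 0 < d).
  { apply Rmin_pos; [lra|]. assert (0 < e * (Cmod a * Cmod a)) by (repeat apply Rmult_lt_0_compat; lra). lra. }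
  generalize (Hf d hd). apply filter_imp. intros y h.
  assert (h1 : Cmod a / 2 < Cmod (f y)).
  { assert (h1 := Rmin_l (Cmod a / 2) (e * (Cmod a * Cmod a) / 4)). fold d in h1.
    rewrite Cmod_minus_comm in h. assert (h2 := Cmod_triangle_rev a (a - f y)).
    replace (a - (a - f y))%C with (f y) in h2 by ring. lra. }
  assert (hf : f y <> 0) by (apply Cmod_gt_0; lra).
  replace (/ f y - / a)%C with ((a - f y) / (f y * a))%C by (field; auto).
  rewrite Cmod_div by (apply Cmult_neq_0; auto). rewrite Cmod_mult.
  apply Rmult_lt_reg_r with (Cmod (f y) * Cmod a); [apply Rmult_lt_0_compat; lra|].
  unfold Rdiv. rewrite Rmult_assoc, Rinv_l by (apply Rgt_not_eq, Rmult_lt_0_compat; lra).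
  rewrite Rmult_1_r, Cmod_minus_comm. eapply Rlt_le_trans; [exact h|].
  eapply Rle_trans; [apply Rmin_r|].
  assert (e * (Cmod a / 2 * Cmod a) <= e * (Cmod (f y) * Cmod a)).
  { apply Rmult_le_compat_l; [lra|]. apply Rmult_le_compat_r; lra. }
  assert (0 < e * (Cmod a * Cmod a)) by (repeat apply Rmult_lt_0_compat; lra). lra.
Qed.

Lemma clim_div (f g : T -> C) (a b : C) : b <> 0 -> clim F f a -> clim F g b -> clim F (fun y => f y / g y)%C (a / b)%C.
Proof. intros hb Hf Hg. apply clim_mult; [exact Hf|]. now apply clim_inv. Qed.

Lemma clim_comp (g : T -> C) (f : C -> C) a b :
  clim F g a -> clim (cnbhd a) f b -> clim F (fun y => f (g y)) b.
Proof.
  intros Hg Hf e he. destruct (Hf e he) as [d [hd H]].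
  generalize (Hg d hd). apply filter_imp. auto.
Qed.

End Limits.

Lemma clim_id z : clim (cnbhd z) (fun y => y) z.
Proof. intros e he. exists e; auto. Qed.

Lemma clim_RtoC (t : R) : clim (locally t) RtoC (RtoC t).
Proof.
  intros e he. exists (mkposreal e he). intros y hy.
  rewrite <- RtoC_minus, Cmod_R. exact hy.
Qed.

(** * Derivatives in Caratheodory form *)

(** The slope [q] is defined at every y, including y = z. Product and chain rules thus become
    identities between slopes followed by limit rules, with no case y = z. *)
Definition cderiv (f : C -> C) (z l : C) : Prop :=
  exists q : C -> C, (forall y, f y = f z + (y - z) * q y)%C /\ q z = l /\ clim (cnbhd z) q l.

Definition rderiv (f : R -> C) (t : R) (l : C) : Prop :=
  exists q : R -> C, (forall s, f s = f t + RtoC (s - t) * q s)%C /\ q t = l /\ clim (locally t) q l.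

Lemma cderiv_eps (f : C -> C) (z l : C) :
  cderiv f z l <->
  forall e, 0 < e -> exists d, 0 < d /\
    forall y, Cmod (y - z) < d -> Cmod (f y - f z - (y - z) * l) <= e * Cmod (y - z).
Proof.
  split.
  - intros [q [E [Eq H]]] e he. destruct (H e he) as [d [hd Hd]]. exists d. split; [exact hd|].
    intros y hy. specialize (Hd y hy). rewrite E.
    replace (f z + (y - z) * q y - f z - (y - z) * l)%C with ((q y - l) * (y - z))%C by ring.
    rewrite Cmod_mult. apply Rmult_le_compat_r; [apply Cmod_ge_0|lra].
  - intros H.
    exists (fun y => if excluded_middle_informative (y = z) then l else ((f y - f z) / (y - z))%C).
    split; [|split].
    + intros y. destruct excluded_middle_informative as [->|n]; [ring|].
      field. intros E. apply n. replace y with ((y - z) + z)%C by ring. rewrite E; ring.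
    + destruct excluded_middle_informative; tauto.
    + intros e he. assert (he2 : 0 < e / 2) by lra.
      destruct (H (e / 2) he2) as [d [hd Hd]]. exists d. split; [exact hd|]. intros y hy.
      destruct excluded_middle_informative as [->|n].
      * rewrite Cmod_minus_diag; exact he.
      * specialize (Hd y hy). assert (hp := Cmod_minus_neq_0 y z n).
        assert (hn : (y - z <> 0)%C) by (apply Cmod_gt_0; assumption).
        replace ((f y - f z) / (y - z) - l)%C with ((f y - f z - (y - z) * l) / (y - z))%C by (now field).
        rewrite Cmod_div by exact hn.
        apply Rle_lt_trans with (e / 2); [|lra].
        apply Rmult_le_reg_r with (Cmod (y - z)); [exact hp|].
        unfold Rdiv at 1. rewrite Rmult_assoc, Rinv_l by lra. lra.
Qed.

Lemma cderiv_is_derive (f : C -> C) (z l : C) : C_is_derive f z l <-> cderiv f z l.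
Proof.
  rewrite cderiv_eps. split.
  - intros [_ H] e he.
    specialize (H z (fun P h => h) (mkposreal e he)).
    apply locally_C in H. apply cnbhd_locally in H. exact H.
  - intros H. split; [apply (is_linear_scal_l (K := C_AbsRing) (V := C_NormedModule))|].
    intros x hx.
    (* [is_derive] speaks of every limit point x of the filter at z; the only one is z. *)
    assert (E : z = x).
    { apply (is_filter_lim_locally_unique (K := C_AbsRing) (V := AbsRing_NormedModule C_AbsRing)). exact hx. }
    subst x. intros [e he]. apply locally_C. apply cnbhd_locally. exact (H e he).
Qed.

Lemma cderiv_val (f : C -> C) (z l m : C) : l = m -> cderiv f z l -> cderiv f z m.
Proof. now intros ->. Qed.

Lemma rderiv_val (f : R -> C) (t : R) (l m : C) : l = m -> rderiv f t l -> rderiv f t m.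
Proof. now intros ->. Qed.

Lemma cderiv_intro (f q : C -> C) (z l : C) :
  cnbhd z (fun y => f y = f z + (y - z) * q y)%C -> clim (cnbhd z) q l -> cderiv f z l.
Proof.
  intros H Hq. apply cderiv_eps. intros e he.
  destruct (filter_and _ _ H (Hq e he)) as [d [hd Hd]]. exists d. split; [exact hd|].
  intros y hy. destruct (Hd y hy) as [E h]. rewrite E.
  replace (f z + (y - z) * q y - f z - (y - z) * l)%C with ((q y - l) * (y - z))%C by ring.
  rewrite Cmod_mult. apply Rmult_le_compat_r; [apply Cmod_ge_0|lra].
Qed.

Lemma cderiv_cont (f : C -> C) (z l : C) : cderiv f z l -> clim (cnbhd z) f (f z).
Proof.
  intros [q [E [Eq H]]].
  apply (clim_ext_loc _ (fun y => f z + (y - z) * q y)%C).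
  { apply filter_forall. intros y. now rewrite (E y). }
  apply (clim_val _ _ (f z + (z - z) * l)%C); [ring|].
  apply clim_plus; [apply _|apply clim_const, _|].
  apply clim_mult; [apply _| |exact H].
  apply clim_minus; [apply _|apply clim_id|apply clim_const, _].
Qed.

Lemma cderiv_ext_loc (f g : C -> C) (z l : C) :
  cnbhd z (fun y => f y = g y) -> cderiv f z l -> cderiv g z l.
Proof.
  intros H [q [E [Eq Hq]]]. apply (cderiv_intro _ q); [|exact Hq].
  assert (Ez : f z = g z).
  { destruct H as [d [hd H]]. apply H. rewrite Cmod_minus_diag; lra. }
  revert H. apply filter_imp. intros y h. rewrite <- h, <- Ez. apply E.
Qed.

Lemma cderiv_ext (f g : C -> C) (z l : C) :
  (forall y, f y = g y) -> cderiv f z l -> cderiv g z l.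
Proof. intros H. apply cderiv_ext_loc. now apply filter_forall. Qed.

Lemma cderiv_unique (f : C -> C) (z l m : C) : cderiv f z l -> cderiv f z m -> l = m.
Proof.
  rewrite !cderiv_eps. intros Hl Hm.
  assert (E : (l - m)%C = 0).
  { apply Cmod_small_eq_0. intros e he. assert (he2 : 0 < e / 2) by lra.
    destruct (Hl _ he2) as [d [hd Hd]]. destruct (Hm _ he2) as [d' [hd' Hd']].
    set (r := Rmin d d' / 2).
    assert (hr : 0 < r) by (assert (h := Rmin_pos _ _ hd hd'); unfold r; lra).
    assert (Er : (z + RtoC r - z)%C = RtoC r) by ring.
    assert (hy : Cmod (z + RtoC r - z) = r).
    { rewrite Er, Cmod_R. apply Rabs_pos_eq; lra. }
    assert (r < d) by (unfold r in *; pose proof (Rmin_l d d'); lra).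
    assert (r < d') by (unfold r in *; pose proof (Rmin_r d d'); lra).
    specialize (Hd (z + RtoC r)%C). specialize (Hd' (z + RtoC r)%C).
    rewrite hy in Hd, Hd'. specialize (Hd H). specialize (Hd' H0). rewrite Er in Hd, Hd'.
    apply Rmult_le_reg_l with r; [exact hr|].
    replace (r * Cmod (l - m)) with (Cmod (RtoC r * (l - m))).
    2:{ rewrite Cmod_mult, Cmod_R, Rabs_pos_eq; lra. }
    set (A := (f (z + RtoC r) - f z)%C) in *.
    replace (RtoC r * (l - m))%C with ((A - RtoC r * m) - (A - RtoC r * l))%C by ring.
    eapply Rle_trans; [apply Cmod_triangle_minus|]. lra. }
  replace l with ((l - m) + m)%C by ring. rewrite E. ring.
Qed.

Lemma cderiv_const (c z : C) : cderiv (fun _ => c) z 0.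
Proof. exists (fun _ => RtoC 0). split; [intros; ring|]. split; [easy|apply clim_const, _]. Qed.

Lemma cderiv_id (z : C) : cderiv (fun y => y) z 1.
Proof. exists (fun _ => RtoC 1). split; [intros; ring|]. split; [easy|apply clim_const, _]. Qed.

Lemma cderiv_plus (f g : C -> C) (z a b : C) :
  cderiv f z a -> cderiv g z b -> cderiv (fun y => f y + g y)%C z (a + b)%C.
Proof.
  intros [q [E [Eq H]]] [q' [E' [Eq' H']]]. exists (fun y => q y + q' y)%C.
  split; [intros; rewrite E, E'; ring|]. split; [now rewrite Eq, Eq'|].
  apply clim_plus; auto; apply _.
Qed.

Lemma cderiv_mult (f g : C -> C) (z a b : C) :
  cderiv f z a -> cderiv g z b -> cderiv (fun y => f y * g y)%C z (a * g z + f z * b)%C.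
Proof.
  intros Hf Hg. assert (Hc := cderiv_cont _ _ _ Hg).
  destruct Hf as [q [E [Eq H]]]. destruct Hg as [q' [E' [Eq' H']]].
  exists (fun y => q y * g y + f z * q' y)%C.
  split; [intros y; rewrite (E y), (E' y); ring|]. split; [now rewrite Eq, Eq'|].
  apply clim_plus; [apply _| |].
  - apply clim_mult; auto; apply _.
  - apply clim_mult; auto; [apply _|apply clim_const, _].
Qed.

Lemma cderiv_scal (c : C) (f : C -> C) (z a : C) :
  cderiv f z a -> cderiv (fun y => c * f y)%C z (c * a)%C.
Proof.
  intros H. replace (c * a)%C with (0 * f z + c * a)%C by ring.
  apply (cderiv_mult (fun _ => c)); [apply cderiv_const|exact H].
Qed.

Lemma cderiv_minus (f g : C -> C) (z a b : C) :
  cderiv f z a -> cderiv g z b -> cderiv (fun y => f y - g y)%C z (a - b)%C.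
Proof.
  intros Hf Hg. apply (cderiv_ext (fun y => f y + -1 * g y)%C); [intros; ring|].
  replace (a - b)%C with (a + -1 * b)%C by ring.
  apply cderiv_plus; [exact Hf|]. now apply cderiv_scal.
Qed.

Lemma cderiv_comp (f g : C -> C) (z a b : C) :
  cderiv f (g z) a -> cderiv g z b -> cderiv (fun y => f (g y)) z (b * a)%C.
Proof.
  intros [q [E [Eq H]]] Hg. assert (Hc := cderiv_cont _ _ _ Hg).
  destruct Hg as [q' [E' [Eq' H']]].
  exists (fun y => q' y * q (g y))%C.
  split; [intros y; rewrite (E (g y)), (E' y) at 1; ring|]. split; [now rewrite Eq, Eq'|].
  apply clim_mult; [apply _|exact H'|]. apply (clim_comp _ g q (g z)); auto; apply _.
Qed.

Lemma cnbhd_neq (z a : C) : z <> a -> cnbhd z (fun y => y <> a).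
Proof.
  intros h. exists (Cmod (z - a)). split; [now apply Cmod_minus_neq_0|].
  intros y hy E. subst y. rewrite Cmod_minus_comm in hy. lra.
Qed.

Lemma cderiv_inv (z : C) : z <> 0 -> cderiv (fun y => / y)%C z (- / (z * z))%C.
Proof.
  intros hz. apply (cderiv_intro _ (fun y => - / (z * y))%C).
  - generalize (cnbhd_neq z 0 hz). apply filter_imp. intros y hy. field; auto.
  - apply clim_opp; [apply _|]. apply clim_inv; [apply _|apply Cmult_neq_0; auto|].
    apply clim_mult; [apply _|apply clim_const, _|apply clim_id].
Qed.

Lemma cderiv_pow (k : nat) (z : C) :
  cderiv (fun y => y ^ k)%C z (RtoC (INR k) * z ^ (k - 1))%C.
Proof.
  induction k as [|k IH].
  - simpl. replace (RtoC 0 * 1)%C with (RtoC 0) by ring. apply cderiv_const.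
  - apply (cderiv_ext (fun y => y * y ^ k)%C); [intros; now rewrite Cpow_S|].
    replace (RtoC (INR (S k)) * z ^ (S k - 1))%C with (1 * z ^ k + z * (RtoC (INR k) * z ^ (k - 1)))%C.
    + apply cderiv_mult; [apply cderiv_id|exact IH].
    + rewrite S_INR, RtoC_plus. replace (S k - 1)%nat with k by lia.
      destruct k as [|k]; [simpl; ring|].
      replace (S k - 1)%nat with k by lia. rewrite Cpow_S. ring.
Qed.

Lemma rderiv_RtoC (t : R) : rderiv RtoC t 1.
Proof.
  exists (fun _ => RtoC 1). split; [intros; rewrite RtoC_minus; ring|].
  split; [easy|apply clim_const, _].
Qed.

Lemma rderiv_cont (f : R -> C) (t : R) (l : C) : rderiv f t l -> clim (locally t) f (f t).
Proof.
  intros [q [E [Eq H]]].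
  apply (clim_ext_loc _ (fun s => f t + (RtoC s - RtoC t) * q s)%C).
  { apply filter_forall. intros y. rewrite (E y), RtoC_minus. reflexivity. }
  apply (clim_val _ _ (f t + (RtoC t - RtoC t) * l)%C); [ring|].
  apply clim_plus; [apply _|apply clim_const, _|].
  apply clim_mult; [apply _| |exact H].
  apply clim_minus; [apply _|apply clim_RtoC|apply clim_const, _].
Qed.

Lemma rderiv_comp (f : C -> C) (g : R -> C) (t : R) (a b : C) :
  cderiv f (g t) a -> rderiv g t b -> rderiv (fun s => f (g s)) t (b * a)%C.
Proof.
  intros [q [E [Eq H]]] Hg. assert (Hc := rderiv_cont _ _ _ Hg).
  destruct Hg as [q' [E' [Eq' H']]].
  exists (fun y => q' y * q (g y))%C.
  split; [intros y; rewrite (E (g y)), (E' y) at 1; ring|]. split; [now rewrite Eq, Eq'|].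
  apply clim_mult; [apply _|exact H'|]. apply (clim_comp _ g q (g t)); auto; apply _.
Qed.

(** The bridge to real analysis: the fundamental theorem of calculus and the constancy of functions
    with zero derivative are applied to the two components. *)
Lemma rderiv_Re_Im (f : R -> C) (t : R) (l : C) :
  rderiv f t l <-> is_derive (fun s => Re (f s)) t (Re l) /\ is_derive (fun s => Im (f s)) t (Im l).
Proof.
  split.
  - intros [q [E [Eq H]]].
    split; apply is_derive_Reals; intros e he;
      destruct (H e he) as [d Hd]; exists d; intros h hh hd;
      (assert (hb : ball t d (t + h))
        by (change (Rabs (t + h - t) < d); replace (t + h - t) with h by ring; exact hd));
      specialize (Hd _ hb); rewrite (E (t + h));
      replace (t + h - t) with h by ring.
    + eapply Rle_lt_trans; [|exact Hd]. eapply Rle_trans; [|apply re_le_Cmod].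
      right. f_equal. unfold Re, Cplus, Cmult, Cminus, Copp, RtoC; simpl. now field.
    + eapply Rle_lt_trans; [|exact Hd]. eapply Rle_trans; [|apply im_le_Cmod].
      right. f_equal. unfold Im, Cplus, Cmult, Cminus, Copp, RtoC; simpl. now field.
  - intros [H1 H2]. apply is_derive_Reals in H1. apply is_derive_Reals in H2.
    exists (fun s => if Req_EM_T s t then l else ((f s - f t) / RtoC (s - t))%C).
    split; [|split].
    + intros s. destruct Req_EM_T as [->|n].
      * replace (t - t) with 0 by ring. ring.
      * field. intros E. apply RtoC_inj in E. lra.
    + destruct Req_EM_T; tauto.
    + intros e he. assert (he2 : 0 < e / 2) by lra.
      destruct (H1 _ he2) as [d1 Hd1]. destruct (H2 _ he2) as [d2 Hd2].
      exists (mkposreal _ (Rmin_pos _ _ (cond_pos d1) (cond_pos d2))).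
      intros s hs. change R in s. destruct Req_EM_T as [->|n]; [rewrite Cmod_minus_diag; exact he|].
      assert (hs' : Rabs (s - t) < Rmin d1 d2) by exact hs.
      assert (n' : s - t <> 0) by lra.
      specialize (Hd1 (s - t) n' (Rlt_le_trans _ _ _ hs' (Rmin_l _ _))).
      specialize (Hd2 (s - t) n' (Rlt_le_trans _ _ _ hs' (Rmin_r _ _))).
      replace (t + (s - t)) with s in * by (change (@eq R s (t + (s - t))); ring).
      eapply Rle_lt_trans; [apply Cmod_le_Re_Im|].
      replace (Re ((f s - f t) / RtoC (s - t) - l)) with ((Re (f s) - Re (f t)) / (s - t) - Re l).
      2:{ unfold Re, Cdiv, Cinv, Cplus, Cmult, Cminus, Copp, RtoC; simpl. field. nra. }
      replace (Im ((f s - f t) / RtoC (s - t) - l)) with ((Im (f s) - Im (f t)) / (s - t) - Im l).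
      2:{ unfold Im, Cdiv, Cinv, Cplus, Cmult, Cminus, Copp, RtoC; simpl. field. nra. }
      lra.
Qed.

(** * Integrals of complex-valued functions of a real variable *)

(** Continuity is asked on the whole line and not just on the interval of integration; the
    integrands below all have it, and integrability then holds between any bounds. *)
Definition rcont (f : R -> C) : Prop := forall t, clim (locally t) f (f t).

Definition ccont (f : C -> C) : Prop := forall z, clim (cnbhd z) f (f z).

Definition CInt (f : R -> C) (a b : R) : C :=
  (RInt (fun t => Re (f t)) a b, RInt (fun t => Im (f t)) a b).

Lemma rcont_const (c : C) : rcont (fun _ => c).
Proof. intros t. apply clim_const, _. Qed.

Lemma rcont_plus (f g : R -> C) : rcont f -> rcont g -> rcont (fun t => f t + g t)%C.
Proof. intros Hf Hg t. apply clim_plus; auto; apply _. Qed.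

Lemma rcont_minus (f g : R -> C) : rcont f -> rcont g -> rcont (fun t => f t - g t)%C.
Proof. intros Hf Hg t. apply clim_minus; auto; apply _. Qed.

Lemma rcont_mult (f g : R -> C) : rcont f -> rcont g -> rcont (fun t => f t * g t)%C.
Proof. intros Hf Hg t. apply clim_mult; auto; apply _. Qed.

Lemma rcont_div (f g : R -> C) : rcont f -> rcont g -> (forall t, g t <> 0) -> rcont (fun t => f t / g t)%C.
Proof. intros Hf Hg H t. apply clim_div; auto; apply _. Qed.

Lemma rcont_comp (f : C -> C) (g : R -> C) : ccont f -> rcont g -> rcont (fun t => f (g t)).
Proof. intros Hf Hg t. apply (clim_comp _ g f (g t)); auto; apply _. Qed.

Lemma rcont_RtoC : rcont RtoC.
Proof. intros t. apply clim_RtoC. Qed.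

Lemma rcont_Re (f : R -> C) : rcont f -> forall t, continuous (fun s => Re (f s)) t.
Proof.
  intros H t P [d Hd]. destruct (H t d (cond_pos d)) as [e He]. exists e. intros s hs.
  apply Hd. eapply Rle_lt_trans; [apply (re_le_Cmod (f s - f t))|]. now apply He.
Qed.

Lemma rcont_Im (f : R -> C) : rcont f -> forall t, continuous (fun s => Im (f s)) t.
Proof.
  intros H t P [d Hd]. destruct (H t d (cond_pos d)) as [e He]. exists e. intros s hs.
  apply Hd. eapply Rle_lt_trans; [apply (im_le_Cmod (f s - f t))|]. now apply He.
Qed.

Lemma ex_RInt_Re (f : R -> C) a b : rcont f -> ex_RInt (fun t => Re (f t)) a b.
Proof. intros H. apply (ex_RInt_continuous (V := R_CompleteNormedModule)). intros. now apply rcont_Re. Qed.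

Lemma ex_RInt_Im (f : R -> C) a b : rcont f -> ex_RInt (fun t => Im (f t)) a b.
Proof. intros H. apply (ex_RInt_continuous (V := R_CompleteNormedModule)). intros. now apply rcont_Im. Qed.

Lemma CInt_ext (f g : R -> C) a b : (forall t, f t = g t) -> CInt f a b = CInt g a b.
Proof. intros H. unfold CInt. f_equal; apply RInt_ext; intros; now rewrite H. Qed.

Lemma CInt_plus (f g : R -> C) a b : rcont f -> rcont g ->
  CInt (fun t => f t + g t)%C a b = (CInt f a b + CInt g a b)%C.
Proof.
  intros Hf Hg. unfold CInt, Cplus; simpl. f_equal.
  - rewrite <- (RInt_plus (V := R_CompleteNormedModule)) by (now apply ex_RInt_Re). reflexivity.
  - rewrite <- (RInt_plus (V := R_CompleteNormedModule)) by (now apply ex_RInt_Im). reflexivity.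
Qed.

Lemma CInt_scal (c : C) (f : R -> C) a b : rcont f ->
  CInt (fun t => c * f t)%C a b = (c * CInt f a b)%C.
Proof.
  intros Hf. assert (H1 := ex_RInt_Re f a b Hf). assert (H2 := ex_RInt_Im f a b Hf).
  destruct c as [x y]. unfold CInt, Cmult; simpl. f_equal.
  - transitivity (minus (scal x (RInt (fun t => Re (f t)) a b)) (scal y (RInt (fun t => Im (f t)) a b))); [|reflexivity].
    rewrite <- !(RInt_scal (V := R_CompleteNormedModule)) by assumption.
    rewrite <- (RInt_minus (V := R_CompleteNormedModule)); [reflexivity| |];
      now apply (ex_RInt_scal (V := R_NormedModule)).
  - transitivity (plus (scal x (RInt (fun t => Im (f t)) a b)) (scal y (RInt (fun t => Re (f t)) a b))); [|reflexivity].
    rewrite <- !(RInt_scal (V := R_CompleteNormedModule)) by assumption.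
    rewrite <- (RInt_plus (V := R_CompleteNormedModule)); [reflexivity| |];
      now apply (ex_RInt_scal (V := R_NormedModule)).
Qed.

Lemma CInt_minus (f g : R -> C) a b : rcont f -> rcont g ->
  CInt (fun t => f t - g t)%C a b = (CInt f a b - CInt g a b)%C.
Proof.
  intros Hf Hg. rewrite (CInt_ext _ (fun t => f t + -1 * g t)%C) by (intros; ring).
  rewrite CInt_plus, CInt_scal; auto; [ring|]. apply rcont_mult; auto. apply rcont_const.
Qed.

(* The factor 2 comes from estimating real and imaginary parts separately. *)
Lemma CInt_bound (f : R -> C) a b M : rcont f -> a <= b ->
  (forall t, a <= t <= b -> Cmod (f t) <= M) -> Cmod (CInt f a b) <= 2 * ((b - a) * M).
Proof.
  intros Hf hab H. eapply Rle_trans; [apply Cmod_le_Re_Im|].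
  replace (2 * ((b - a) * M)) with ((b - a) * M + (b - a) * M) by ring.
  apply Rplus_le_compat.
  - apply (norm_RInt_le_const (V := R_NormedModule) (fun t => Re (f t)) a b); auto.
    + intros t ht. eapply Rle_trans; [apply re_le_Cmod|auto].
    + apply (RInt_correct (V := R_CompleteNormedModule)). now apply ex_RInt_Re.
  - apply (norm_RInt_le_const (V := R_NormedModule) (fun t => Im (f t)) a b); auto.
    + intros t ht. eapply Rle_trans; [apply im_le_Cmod|auto].
    + apply (RInt_correct (V := R_CompleteNormedModule)). now apply ex_RInt_Im.
Qed.

Lemma CInt_deriv (P p : R -> C) a b : (forall t, rderiv P t (p t)) -> rcont p ->
  CInt p a b = (P b - P a)%C.
Proof.
  intros HP Hp. unfold CInt, Cminus, Cplus, Copp; simpl. f_equal.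
  - apply is_RInt_unique. apply (is_RInt_derive (fun t => Re (P t))).
    + intros t _. apply (proj1 (rderiv_Re_Im P t (p t))). apply HP.
    + intros t _. now apply rcont_Re.
  - apply is_RInt_unique. apply (is_RInt_derive (fun t => Im (P t))).
    + intros t _. apply (proj1 (rderiv_Re_Im P t (p t))). apply HP.
    + intros t _. now apply rcont_Im.
Qed.

Lemma CInt_const (c : C) a b : CInt (fun _ => c) a b = (RtoC (b - a) * c)%C.
Proof.
  rewrite (CInt_deriv (fun t => c * RtoC t)%C).
  - rewrite RtoC_minus. ring.
  - intros t. apply (rderiv_val _ _ (1 * (c * 1))%C); [ring|].
    apply (rderiv_comp (fun y => c * y)%C RtoC); [|apply rderiv_RtoC].
    apply cderiv_scal, cderiv_id.
  - apply rcont_const.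
Qed.

Lemma RInt_comp_affine (g : R -> R) u v : (forall t, continuous g t) ->
  RInt (fun t => g (u * t + v)) 0 1 * u = RInt g v (u + v).
Proof.
  intros Hg.
  assert (E := RInt_comp_lin (V := R_CompleteNormedModule) g u v 0 1).
  replace (u * 0 + v) with v in E by ring. replace (u * 1 + v) with (u + v) in E by ring.
  rewrite <- E.
  2:{ apply (ex_RInt_continuous (V := R_CompleteNormedModule)). auto. }
  rewrite (RInt_scal (V := R_CompleteNormedModule)).
  - unfold scal; simpl. unfold mult; simpl. ring.
  - apply (ex_RInt_continuous (V := R_CompleteNormedModule)). intros t _.
    apply (continuous_comp (fun t => u * t + v) g); [|apply Hg].
    apply (continuous_plus (V := R_NormedModule)); [|apply continuous_const].
    apply (continuous_scal_r (V := R_NormedModule) u (fun t => t)). apply continuous_id.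
Qed.

Lemma CInt_comp_affine (f : R -> C) u v : rcont f ->
  (RtoC u * CInt (fun t => f (u * t + v)%R) 0 1)%C = CInt f v (u + v).
Proof.
  intros Hf. unfold CInt, Cmult; simpl. f_equal.
  - rewrite <- (RInt_comp_affine (fun t => Re (f t))) by now apply rcont_Re. ring.
  - rewrite <- (RInt_comp_affine (fun t => Im (f t))) by now apply rcont_Im. ring.
Qed.

Lemma CInt_Chasles (f : R -> C) a b c : rcont f ->
  (CInt f a b + CInt f b c)%C = CInt f a c.
Proof.
  intros Hf. unfold CInt, Cplus; simpl. f_equal.
  - apply (RInt_Chasles (V := R_CompleteNormedModule)); now apply ex_RInt_Re.
  - apply (RInt_Chasles (V := R_CompleteNormedModule)); now apply ex_RInt_Im.
Qed.

Lemma CInt_point (f : R -> C) a : CInt f a a = 0.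
Proof.
  unfold CInt, RtoC.
  f_equal; exact (RInt_point (V := R_CompleteNormedModule) a _).
Qed.

(** * Goursat's theorem and primitives *)

(** The intervals of radius [u n] around [x n] are nested, since a step is at most [u n - u (S n)];
    the supremum of their left ends lies in all of them. The explicit rate is used for shrinking
    triangles and for fixed-point iteration. *)
Lemma geometric_steps_limit_R (x : nat -> R) (M : R) :
  (forall n, Rabs (x (S n) - x n) <= M * (1 / 2) ^ n) ->
  exists p, forall n, Rabs (x n - p) <= 2 * M * (1 / 2) ^ n.
Proof.
  intros H.
  set (u := fun n => 2 * M * (1 / 2) ^ n).
  assert (hM : 0 <= M).
  { specialize (H O). simpl in H. pose proof (Rabs_pos (x 1%nat - x O)). lra. }
  assert (hu : forall n, 0 <= u n).
  { intros n. unfold u. apply Rmult_le_pos; [lra|]. apply pow_le; lra. }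
  assert (hstep : forall n, Rabs (x (S n) - x n) <= u n - u (S n)).
  { intros n. eapply Rle_trans; [apply H|]. unfold u; simpl. lra. }
  assert (hup : forall n k, Rabs (x (n + k)%nat - x n) <= u n - u (n + k)%nat).
  { intros n k. induction k as [|k IH].
    - rewrite Nat.add_0_r, Rminus_diag, Rabs_R0. lra.
    - rewrite Nat.add_succ_r. specialize (hstep (n + k)%nat).
      replace (x (S (n + k)) - x n) with ((x (S (n + k)) - x (n + k)%nat) + (x (n + k)%nat - x n)) by ring.
      eapply Rle_trans; [apply Rabs_triang|]. lra. }
  assert (hall : forall n m, x n - u n <= x m + u m).
  { intros n m. destruct (Nat.le_ge_cases n m) as [h|h].
    - replace m with (n + (m - n))%nat by lia. specialize (hup n (m - n)%nat).
      apply Rabs_le_between in hup. specialize (hu (n + (m - n))%nat). lra.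
    - replace n with (m + (n - m))%nat by lia. specialize (hup m (n - m)%nat).
      apply Rabs_le_between in hup. specialize (hu (m + (n - m))%nat). lra. }
  destruct (completeness (fun y => exists n, y = x n - u n)) as [p [h1 h2]].
  - exists (x O + u O). intros y [n ->]. apply hall.
  - exists (x O - u O), O. reflexivity.
  - exists p. intros n. apply Rabs_le_between.
    assert (x n - u n <= p) by (apply h1; now exists n).
    assert (p <= x n + u n) by (apply h2; intros y [m ->]; apply hall).
    fold (u n). lra.
Qed.

(** Each component contributes an error 2 M, hence the constant 4. *)
Lemma geometric_steps_limit (x : nat -> C) (M : R) :
  (forall n, Cmod (x (S n) - x n) <= M * (1 / 2) ^ n) ->
  exists p : C, forall n, Cmod (x n - p) <= 4 * M * (1 / 2) ^ n.
Proof.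
  intros H.
  destruct (geometric_steps_limit_R (fun n => Re (x n)) M) as [p Hp].
  { intros n. eapply Rle_trans; [|apply H]. apply (re_le_Cmod (x (S n) - x n)). }
  destruct (geometric_steps_limit_R (fun n => Im (x n)) M) as [q Hq].
  { intros n. eapply Rle_trans; [|apply H]. apply (im_le_Cmod (x (S n) - x n)). }
  exists (p, q). intros n. eapply Rle_trans; [apply Cmod_le_Re_Im|].
  specialize (Hp n). specialize (Hq n).
  change (Re (x n - (p, q))) with (Re (x n) - p). change (Im (x n - (p, q))) with (Im (x n) - q). lra.
Qed.

(** The contour integral of f along the straight segment from a to b; [tri] is the integral around
    the boundary of a triangle, possibly degenerate. *)
Definition seg (f : C -> C) (a b : C) : C :=
  ((b - a) * CInt (fun t => f (a + RtoC t * (b - a))%C) 0 1)%C.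

Definition tri (f : C -> C) (a b c : C) : C := (seg f a b + seg f b c + seg f c a)%C.

Lemma rcont_segment (f : C -> C) (a b : C) :
  ccont f -> rcont (fun t => f (a + RtoC t * (b - a))%C).
Proof.
  intros Hf. apply rcont_comp; [exact Hf|]. apply rcont_plus; [apply rcont_const|].
  apply rcont_mult; [apply rcont_RtoC|apply rcont_const].
Qed.

Lemma seg_swap (f : C -> C) (a b : C) : ccont f -> seg f b a = (- seg f a b)%C.
Proof.
  intros Hf. unfold seg. set (h := fun t => f (a + RtoC t * (b - a))%C).
  assert (Hh : rcont h) by (now apply rcont_segment).
  rewrite (CInt_ext _ (fun t => h (-1 * t + 1)%R)).
  2:{ intros t. unfold h. f_equal. rewrite RtoC_plus, RtoC_mult. ring. }
  assert (E := CInt_comp_affine h (-1) 1 Hh).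
  replace (-1 + 1) with 0 in E by ring.
  assert (E2 := CInt_Chasles h 0 1 0 Hh). rewrite CInt_point in E2.
  rewrite <- E in E2.
  set (X := CInt (fun t => h (-1 * t + 1)%R) 0 1) in *. set (Y := CInt h 0 1) in *.
  replace X with Y; [ring|]. replace Y with (Y + RtoC (-1) * X + X)%C by ring. rewrite E2. ring.
Qed.

Lemma seg_midpoint (f : C -> C) (a b : C) : ccont f ->
  seg f a b = (seg f a ((a + b) / 2) + seg f ((a + b) / 2) b)%C.
Proof.
  intros Hf. unfold seg. set (h := fun t => f (a + RtoC t * (b - a))%C).
  assert (Hh : rcont h) by (now apply rcont_segment).
  assert (E2 : RtoC 2 <> 0) by (apply RtoC_neq_0; lra).
  assert (Eh : RtoC (1 / 2) = (/ 2)%C) by (rewrite RtoC_div; [field; exact E2|lra]).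
  rewrite (CInt_ext (fun t => f (a + RtoC t * ((a + b) / 2 - a))%C) (fun t => h (1 / 2 * t + 0)%R)).
  2:{ intros t. unfold h. f_equal. rewrite RtoC_plus, RtoC_mult, Eh. now field. }
  rewrite (CInt_ext (fun t => f ((a + b) / 2 + RtoC t * (b - (a + b) / 2))%C) (fun t => h (1 / 2 * t + 1 / 2)%R)).
  2:{ intros t. unfold h. f_equal. rewrite RtoC_plus, RtoC_mult, Eh. now field. }
  rewrite <- (CInt_Chasles h 0 (1 / 2) 1 Hh).
  assert (E := CInt_comp_affine h (1 / 2) 0 Hh). rewrite Rplus_0_r in E. rewrite <- E.
  assert (E' := CInt_comp_affine h (1 / 2) (1 / 2) Hh).
  replace (1 / 2 + 1 / 2) with 1 in E' by lra. rewrite <- E', Eh. now field.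
Qed.

Lemma seg_minus (f g : C -> C) (a b : C) : ccont f -> ccont g ->
  seg (fun z => f z - g z)%C a b = (seg f a b - seg g a b)%C.
Proof.
  intros Hf Hg. unfold seg.
  rewrite (CInt_minus (fun t => f (a + RtoC t * (b - a))%C) (fun t => g (a + RtoC t * (b - a))%C));
    [ring| |]; now apply rcont_segment.
Qed.

Lemma seg_const (c a b : C) : seg (fun _ => c) a b = ((b - a) * c)%C.
Proof. unfold seg. rewrite CInt_const. replace (1 - 0) with 1 by ring. ring. Qed.

Lemma rderiv_segment (F f : C -> C) (a b : C) (t : R) :
  (forall z, cderiv F z (f z)) ->
  rderiv (fun t => F (a + RtoC t * (b - a))%C) t ((b - a) * f (a + RtoC t * (b - a)))%C.
Proof.
  intros HF. apply (rderiv_comp F (fun t => a + RtoC t * (b - a))%C); [apply HF|].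
  apply (rderiv_val _ _ (1 * (0 + (1 * (b - a) + RtoC t * 0)))%C); [ring|].
  apply (rderiv_comp (fun y => a + y * (b - a))%C RtoC); [|apply rderiv_RtoC].
  apply (cderiv_plus (fun _ => a) (fun y => y * (b - a))%C); [apply cderiv_const|].
  apply (cderiv_mult (fun y => y) (fun _ => b - a)%C); [apply cderiv_id|apply cderiv_const].
Qed.

Lemma seg_deriv (F f : C -> C) (a b : C) : (forall z, cderiv F z (f z)) -> ccont f ->
  seg f a b = (F b - F a)%C.
Proof.
  intros HF Hf. unfold seg. rewrite <- CInt_scal by now apply rcont_segment.
  rewrite (CInt_deriv (fun t => F (a + RtoC t * (b - a))%C)).
  - f_equal; [f_equal; ring|]. do 2 f_equal. ring.
  - intros t. now apply rderiv_segment.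
  - apply rcont_mult; [apply rcont_const|]. now apply rcont_segment.
Qed.

Lemma seg_bound (f : C -> C) (a b : C) (M : R) : ccont f ->
  (forall t, 0 <= t <= 1 -> Cmod (f (a + RtoC t * (b - a))%C) <= M) ->
  Cmod (seg f a b) <= 2 * (Cmod (b - a) * M).
Proof.
  intros Hf H. unfold seg. rewrite Cmod_mult.
  assert (h := CInt_bound _ 0 1 M (rcont_segment f a b Hf) Rle_0_1 H).
  replace (2 * (Cmod (b - a) * M)) with (Cmod (b - a) * (2 * ((1 - 0) * M))) by ring.
  apply Rmult_le_compat_l; [apply Cmod_ge_0|exact h].
Qed.

Definition centire (f : C -> C) : Prop := forall z, exists l, cderiv f z l.

Lemma centire_cont (f : C -> C) : centire f -> ccont f.
Proof. intros H z. destruct (H z) as [l Hl]. now apply (cderiv_cont _ _ l). Qed.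

(** Vertices are bundled so that subdivision can be iterated as a map on triangles. *)
Definition triangle : Type := ((C * C) * C)%type.
Definition tri' (f : C -> C) (T : triangle) : C := tri f (fst (fst T)) (snd (fst T)) (snd T).
Definition diam_le (T : triangle) (d : R) : Prop :=
  Cmod (snd (fst T) - fst (fst T)) <= d /\ Cmod (snd T - snd (fst T)) <= d /\
  Cmod (fst (fst T) - snd T) <= d.

Lemma Cmod_half (z : C) (d : R) : Cmod z <= d -> Cmod (z / 2) <= d / 2.
Proof.
  intros h. rewrite Cmod_div by (apply RtoC_neq_0; lra).
  rewrite Cmod_R, (Rabs_pos_eq 2) by lra. lra.
Qed.

(** In the midpoint subdivision the inner edges cancel, so one of the four pieces carries at least a
    quarter of the integral. The shift of the first vertex is recorded because these vertices will
    form the convergent sequence. *)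
Lemma tri_subdivide (f : C -> C) (T : triangle) : ccont f ->
  exists T' : triangle, Cmod (tri' f T) <= 4 * Cmod (tri' f T') /\
    forall d, diam_le T d -> diam_le T' (d / 2) /\ Cmod (fst (fst T') - fst (fst T)) <= d / 2.
Proof.
  intros Hf. destruct T as [[a b] c].
  set (p := ((a + b) / 2)%C). set (q := ((b + c) / 2)%C). set (r := ((c + a) / 2)%C).
  assert (E2 : RtoC 2 <> 0) by (apply RtoC_neq_0; lra).
  assert (E : tri f a b c = (tri f a p r + tri f p b q + tri f r q c + tri f p q r)%C).
  { unfold tri.
    rewrite (seg_midpoint f a b Hf), (seg_midpoint f b c Hf), (seg_midpoint f c a Hf).
    fold p q r. rewrite (seg_swap f p r Hf), (seg_swap f p q Hf), (seg_swap f q r Hf). ring. }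
  assert (Hd : forall D, diam_le (a, b, c) D ->
    Cmod ((b - a) / 2) <= D / 2 /\ Cmod ((c - b) / 2) <= D / 2 /\ Cmod ((a - c) / 2) <= D / 2 /\
    Cmod ((a - b) / 2) <= D / 2 /\ Cmod ((b - c) / 2) <= D / 2 /\ Cmod ((c - a) / 2) <= D / 2 /\ Cmod 0 <= D / 2).
  { intros D [h1 [h2 h3]]; simpl in *.
    repeat split; try (apply Cmod_half; auto; rewrite Cmod_minus_comm; auto; fail).
    rewrite Cmod_0. pose proof (Cmod_ge_0 (b - a)). lra. }
  assert (Hmax : Cmod (tri f a b c) <= 4 * Cmod (tri f a p r) \/ Cmod (tri f a b c) <= 4 * Cmod (tri f p b q) \/
    Cmod (tri f a b c) <= 4 * Cmod (tri f r q c) \/ Cmod (tri f a b c) <= 4 * Cmod (tri f p q r)).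
  { assert (h : Cmod (tri f a b c) <= Cmod (tri f a p r) + Cmod (tri f p b q) + Cmod (tri f r q c) + Cmod (tri f p q r)).
    { rewrite E. do 3 (eapply Rle_trans; [apply Cmod_triangle|]; apply Rplus_le_compat_r). apply Rle_refl. }
    destruct (Rle_dec (Cmod (tri f a b c)) (4 * Cmod (tri f a p r))); auto.
    destruct (Rle_dec (Cmod (tri f a b c)) (4 * Cmod (tri f p b q))); auto.
    destruct (Rle_dec (Cmod (tri f a b c)) (4 * Cmod (tri f r q c))); auto.
    right; right; right. lra. }
  (* Every side of a piece, and every shift of a first vertex, is half a side of the original up to
     sign, or zero. *)
  assert (e1 : (p - a = (b - a) / 2)%C) by (unfold p; now field).
  assert (e2 : (r - p = (c - b) / 2)%C) by (unfold p, r; now field).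
  assert (e3 : (a - r = (a - c) / 2)%C) by (unfold r; now field).
  assert (e4 : (b - p = (b - a) / 2)%C) by (unfold p; now field).
  assert (e5 : (q - b = (c - b) / 2)%C) by (unfold q; now field).
  assert (e6 : (p - q = (a - c) / 2)%C) by (unfold p, q; now field).
  assert (e7 : (q - r = (b - a) / 2)%C) by (unfold q, r; now field).
  assert (e8 : (c - q = (c - b) / 2)%C) by (unfold q; now field).
  assert (e9 : (r - c = (a - c) / 2)%C) by (unfold r; now field).
  assert (e10 : (q - p = (c - a) / 2)%C) by (unfold p, q; now field).
  assert (e11 : (r - q = (a - b) / 2)%C) by (unfold q, r; now field).
  assert (e12 : (p - r = (b - c) / 2)%C) by (unfold p, r; now field).
  assert (e13 : (r - a = (c - a) / 2)%C) by (unfold r; now field).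
  assert (e14 : (a - a = 0)%C) by ring.
  destruct Hmax as [h|[h|[h|h]]];
    [exists (a, p, r)|exists (p, b, q)|exists (r, q, c)|exists (p, q, r)];
    (split; [exact h|]); intros D HD; specialize (Hd D HD); unfold diam_le; simpl;
    rewrite ?e1, ?e2, ?e3, ?e4, ?e5, ?e6, ?e7, ?e8, ?e9, ?e10, ?e11, ?e12, ?e13, ?e14; tauto.
Qed.

Lemma tri_deriv (F f : C -> C) (a b c : C) : (forall z, cderiv F z (f z)) -> ccont f -> tri f a b c = 0.
Proof. intros HF Hf. unfold tri. rewrite !(seg_deriv F f) by auto. ring. Qed.

(** An affine function has an explicit quadratic primitive. *)
Lemma tri_affine (m l p a b c : C) : tri (fun z => m + (z - p) * l)%C a b c = 0.
Proof.
  assert (E2 : RtoC 2 <> 0) by (apply RtoC_neq_0; lra).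
  apply (tri_deriv (fun z => m * z + l / 2 * ((z - p) * (z - p)))%C).
  - intros z. apply (cderiv_val _ _ (m * 1 + l / 2 * ((1 - 0) * (z - p) + (z - p) * (1 - 0)))%C).
    { now field. }
    apply cderiv_plus; [apply cderiv_scal, cderiv_id|]. apply cderiv_scal.
    assert (H : cderiv (fun y => y - p)%C z (1 - 0)%C).
    { apply cderiv_minus; [apply cderiv_id|apply cderiv_const]. }
    exact (cderiv_mult _ _ _ _ _ H H).
  - intros z. apply clim_plus; [apply _|apply clim_const, _|].
    apply clim_mult; [apply _| |apply clim_const, _].
    apply clim_minus; [apply _|apply clim_id|apply clim_const, _].
Qed.

(** After n subdivisions a triangle with sides at most d / 2^n carries at least 4^-n of the
    integral. Near the limit point p, f differs from its affine approximation, whose integral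
    vanishes, by at most e' times the distance to p. The integral over the small triangle is thus of
    order e' d^2 4^-n, and the powers of 4 cancel. *)
Lemma goursat (f : C -> C) (a b c : C) : centire f -> tri f a b c = 0.
Proof.
  intros Hf. assert (Hc := centire_cont f Hf).
  set (step := fun T => proj1_sig (constructive_indefinite_description _ (tri_subdivide f T Hc))).
  assert (Hstep : forall T, Cmod (tri' f T) <= 4 * Cmod (tri' f (step T)) /\
    forall d, diam_le T d -> diam_le (step T) (d / 2) /\ Cmod (fst (fst (step T)) - fst (fst T)) <= d / 2).
  { intros T. unfold step. now destruct constructive_indefinite_description. }
  set (T := fix T n := match n with O => ((a, b), c) | S n => step (T n) end).
  set (d := Cmod (b - a) + Cmod (c - b) + Cmod (a - c)).
  pose proof (Cmod_ge_0 (b - a)) as h1; pose proof (Cmod_ge_0 (c - b)) as h2;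
    pose proof (Cmod_ge_0 (a - c)) as h3.
  assert (hd : 0 <= d) by (unfold d; lra).
  assert (Hdiam : forall n, diam_le (T n) (d * (1 / 2) ^ n)).
  { induction n as [|n IH].
    - unfold diam_le; simpl. unfold d. repeat split; lra.
    - destruct (proj2 (Hstep (T n)) _ IH) as [h _].
      replace (d * (1 / 2) ^ S n) with (d * (1 / 2) ^ n / 2) by (simpl; lra). exact h. }
  assert (Htri : forall n, Cmod (tri f a b c) <= 4 ^ n * Cmod (tri' f (T n))).
  { induction n as [|n IH]; [simpl; change (tri' f (a, b, c)) with (tri f a b c); lra|].
    eapply Rle_trans; [exact IH|]. replace (4 ^ S n) with (4 ^ n * 4) by (simpl; ring).
    rewrite Rmult_assoc. apply Rmult_le_compat_l; [apply pow_le; lra|]. apply Hstep. }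
  destruct (geometric_steps_limit (fun n => fst (fst (T n))) d) as [p Hp].
  { intros n. destruct (proj2 (Hstep (T n)) _ (Hdiam n)) as [_ h].
    eapply Rle_trans; [exact h|]. assert (0 <= d * (1 / 2) ^ n); [|lra].
    apply Rmult_le_pos; [lra|]. apply pow_le; lra. }
  destruct (Hf p) as [l Hl]. pose proof Hl as Hl'. rewrite cderiv_eps in Hl'.
  apply Cmod_small_eq_0. intros e he.
  (* With x = 2^-N, the vertices lie within 4 d x + d x = 5 d x of p and the points of the sides
     within 6 d x. By [seg_bound] each side contributes at most 2 (d x) (e' 6 d x), and the three
     sides together 36 e' (d x)^2. The summand 1 covers d = 0. *)
  set (e' := e / (36 * (d * d) + 1)).
  assert (hdd : 0 <= d * d) by (apply Rmult_le_pos; auto).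
  assert (he' : 0 < e') by (apply Rdiv_lt_0_compat; lra).
  destruct (Hl' e' he') as [dl [hdl Hdl]].
  destruct (pow_lt_1_zero (1 / 2)) with (y := dl / (6 * d + 1)) as [N HN].
  { rewrite Rabs_pos_eq; lra. }
  { apply Rdiv_lt_0_compat; lra. }
  specialize (HN N (Nat.le_refl N)).
  set (x := (1 / 2) ^ N) in *.
  assert (hx : 0 < x) by (apply pow_lt; lra).
  rewrite Rabs_pos_eq in HN by lra.
  assert (hxd : 6 * d * x < dl).
  { apply Rmult_lt_compat_r with (r := 6 * d + 1) in HN; [|lra].
    unfold Rdiv in HN. rewrite Rmult_assoc, Rinv_l in HN by lra. nra. }
  set (A := fun z => (f p + (z - p) * l)%C).
  assert (HA : ccont A).
  { intros z. apply clim_plus; [apply _|apply clim_const, _|].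
    apply clim_mult; [apply _| |apply clim_const, _].
    apply clim_minus; [apply _|apply clim_id|apply clim_const, _]. }
  set (r := fun z => (f z - A z)%C).
  assert (Hr : ccont r).
  { intros z. apply clim_minus; [apply _|apply Hc|apply HA]. }
  assert (Er : tri' f (T N) = tri' r (T N)).
  { unfold tri', tri, r. rewrite !seg_minus by auto.
    assert (E := tri_affine (f p) l p (fst (fst (T N))) (snd (fst (T N))) (snd (T N))).
    fold A in E. unfold tri in E.
    match goal with |- ?u = _ => replace u with (u - 0)%C by ring end.
    rewrite <- E. ring. }
  assert (Hseg : forall u v, Cmod (u - p) <= 5 * (d * x) -> Cmod (v - u) <= d * x ->
    Cmod (seg r u v) <= 12 * e' * ((d * x) * (d * x))).
  { intros u v hu hv.
    assert (hdx : 0 <= d * x) by (apply Rmult_le_pos; lra).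
    eapply Rle_trans; [apply (seg_bound r u v (e' * (6 * (d * x))) Hr)|].
    - intros t ht.
      assert (hz : Cmod (u + RtoC t * (v - u) - p) <= 6 * (d * x)).
      { replace (u + RtoC t * (v - u) - p)%C with ((u - p) + RtoC t * (v - u))%C by ring.
        eapply Rle_trans; [apply Cmod_triangle|]. rewrite Cmod_mult, Cmod_R, Rabs_pos_eq by lra.
        pose proof (Cmod_ge_0 (v - u)). nra. }
      unfold r, A.
      replace (f (u + RtoC t * (v - u)) - (f p + (u + RtoC t * (v - u) - p) * l))%C
        with (f (u + RtoC t * (v - u)) - f p - (u + RtoC t * (v - u) - p) * l)%C by ring.
      eapply Rle_trans; [apply Hdl; lra|]. apply Rmult_le_compat_l; lra.
    - apply Rle_trans with (2 * (d * x * (e' * (6 * (d * x))))); [|right; ring].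
      apply Rmult_le_compat_l; [lra|]. apply Rmult_le_compat_r; [|exact hv].
      apply Rmult_le_pos; lra. }
  assert (HT : Cmod (tri' r (T N)) <= 36 * e' * (d * x * (d * x))).
  { destruct (Hdiam N) as [k1 [k2 k3]]. fold x in k1, k2, k3.
    specialize (Hp N). simpl in Hp. fold x in Hp.
    assert (hdx : 0 <= d * x) by (apply Rmult_le_pos; lra).
    unfold tri', tri.
    eapply Rle_trans; [apply Cmod_triangle|].
    eapply Rle_trans; [apply Rplus_le_compat_r, Cmod_triangle|].
    set (u := fst (fst (T N))) in *. set (v := snd (fst (T N))) in *. set (w := snd (T N)) in *.
    assert (g1 := Hseg u v). assert (g2 := Hseg v w). assert (g3 := Hseg w u).
    assert (t2 := Cmod_minus_trans v u p). assert (t3 := Cmod_minus_trans w u p).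
    rewrite (Cmod_minus_comm w u) in t3.
    specialize (g1 ltac:(lra) k1). specialize (g2 ltac:(lra) k2). specialize (g3 ltac:(lra) k3).
    lra. }
  eapply Rle_trans; [apply (Htri N)|]. rewrite Er.
  apply Rle_trans with (4 ^ N * (36 * e' * (d * x * (d * x)))).
  { apply Rmult_le_compat_l; [apply pow_le; lra|exact HT]. }
  assert (Ex : 4 ^ N * (x * x) = 1).
  { unfold x. rewrite <- !Rpow_mult_distr. replace (4 * (1 / 2 * (1 / 2))) with 1 by field. apply pow1. }
  replace (4 ^ N * (36 * e' * (d * x * (d * x)))) with (e' * (36 * (d * d)) * (4 ^ N * (x * x))) by ring.
  rewrite Ex, Rmult_1_r.
  apply Rle_trans with (e' * (36 * (d * d) + 1)); [nra|].
  unfold e'. right. field. lra.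
Qed.

(** The primitive integrates f along the segment from 0. Goursat on the triangle 0, z, y turns its
    increment into the integral from z to y, which continuity of f at z compares with (y - z) f z.
    The choice e / 2 offsets the factor 2 of [seg_bound]. *)
Lemma centire_primitive (f : C -> C) : centire f -> exists F, forall z, cderiv F z (f z).
Proof.
  intros Hf. assert (Hc := centire_cont f Hf).
  exists (fun z => seg f 0 z). intros z. apply cderiv_eps. intros e he.
  assert (he2 : 0 < e / 2) by lra.
  destruct (Hc z (e / 2) he2) as [d [hd Hd]]. exists d. split; [exact hd|]. intros y hy.
  assert (E := goursat f 0 z y Hf). unfold tri in E. rewrite (seg_swap f 0 y Hc) in E.
  replace (seg f 0 y - seg f 0 z)%C with (seg f z y).
  2:{ replace (seg f z y) with ((seg f 0 z + seg f z y + - seg f 0 y) - seg f 0 z + seg f 0 y)%C by ring.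
      rewrite E. ring. }
  assert (Hk : ccont (fun _ => f z)) by (intros u; apply clim_const, _).
  rewrite <- (seg_const (f z) z y), <- seg_minus by auto.
  eapply Rle_trans; [apply (seg_bound _ z y (e / 2))|].
  - intros u. apply clim_minus; [apply _|apply Hc|apply Hk].
  - intros t ht. apply Rlt_le, Hd.
    replace (z + RtoC t * (y - z) - z)%C with (RtoC t * (y - z))%C by ring.
    rewrite Cmod_mult, Cmod_R, Rabs_pos_eq by lra.
    pose proof (Cmod_ge_0 (y - z)). nra.
  - right; field.
Qed.

(** * Cauchy's integral formula on circles centred at the origin *)

Definition circ (r t : R) : C := (RtoC r * (cos t, sin t))%C.

Lemma rderiv_circ (r t : R) : rderiv (circ r) t (Ci * circ r t)%C.
Proof.
  apply (rderiv_val _ _ ((Ci * (cos t, sin t)) * (r * 1))%C); [unfold circ; ring|].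
  apply (rderiv_comp (fun y => RtoC r * y)%C (fun t => (cos t, sin t))).
  - apply cderiv_scal, cderiv_id.
  - apply rderiv_Re_Im. unfold Re, Im, Cmult, Ci; simpl. split.
    + replace (0 * cos t - 1 * sin t) with (- sin t) by ring. apply is_derive_cos.
    + replace (0 * sin t + 1 * cos t) with (cos t) by ring. apply is_derive_sin.
Qed.

Lemma rcont_circ (r : R) : rcont (circ r).
Proof. intros t. exact (rderiv_cont _ _ _ (rderiv_circ r t)). Qed.

Lemma Cmod_circ (r t : R) : 0 <= r -> Cmod (circ r t) = r.
Proof.
  intros h. unfold circ. rewrite Cmod_mult, Cmod_R, Rabs_pos_eq by exact h.
  replace (Cmod (cos t, sin t)) with 1; [ring|].
  unfold Cmod; simpl. rewrite <- sqrt_1 at 1. f_equal.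
  pose proof (sin2_cos2 t). unfold Rsqr in *. lra.
Qed.

Lemma circ_2PI (r : R) : circ r (2 * PI) = circ r 0.
Proof. unfold circ. now rewrite cos_2PI, sin_2PI, cos_0, sin_0. Qed.

Lemma circ_minus_ge (r t : R) (z : C) : 0 <= r -> r - Cmod z <= Cmod (circ r t - z).
Proof. intros h. rewrite <- (Cmod_circ r t h) at 1. apply Cmod_triangle_rev. Qed.

Lemma circ_neq (r t : R) (z : C) : Cmod z < r -> (circ r t - z)%C <> 0.
Proof.
  intros h. apply Cmod_gt_0. pose proof (Cmod_ge_0 z).
  pose proof (circ_minus_ge r t z). lra.
Qed.

(** For zeta = [circ r t] one has d zeta = i zeta dt, so up to the factor i this is the integral of
    a derivative around a closed curve. The same convention, with i divided out, is used in all
    circle integrals below; hence 2 pi instead of 2 pi i. *)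
Lemma CInt_loop (r : R) (P : C -> C) (p : R -> C) :
  (forall t, cderiv P (circ r t) (p t)) -> rcont p ->
  CInt (fun t => circ r t * p t)%C 0 (2 * PI) = 0.
Proof.
  intros HP Hp.
  assert (hc : rcont (fun t => circ r t * p t)%C) by (apply rcont_mult; [apply rcont_circ|exact Hp]).
  assert (E : CInt (fun t => Ci * (circ r t * p t))%C 0 (2 * PI) = 0).
  { rewrite (CInt_deriv (fun t => P (circ r t))).
    - rewrite circ_2PI. ring.
    - intros t. apply (rderiv_val _ _ ((Ci * circ r t) * p t)%C); [ring|].
      apply rderiv_comp; [apply HP|apply rderiv_circ].
    - apply rcont_mult; [apply rcont_const|exact hc]. }
  rewrite CInt_scal in E by exact hc.
  match goal with |- ?u = _ => replace u with ((- Ci) * (Ci * u))%C end.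
  - rewrite E. ring.
  - match goal with |- (?v * (?w * ?u))%C = _ => replace (v * (w * u))%C with ((- (Ci * Ci)) * u)%C by ring end.
    replace (Ci * Ci)%C with (RtoC (-1)); [ring|].
    unfold Ci, Cmult, RtoC; simpl. f_equal; ring.
Qed.

Lemma CInt_circ (r : R) : CInt (circ r) 0 (2 * PI) = 0.
Proof.
  rewrite (CInt_ext _ (fun t => circ r t * 1)%C) by (intros; ring).
  apply (CInt_loop r (fun y => y)); [intros; apply cderiv_id|apply rcont_const].
Qed.

(** A first-order remainder that is uniform in t survives integration by [CInt_bound], at the price
    of the factor 2 (b - a). *)
Lemma cderiv_CInt (Phi : C -> R -> C) (z : C) (dPhi : R -> C) (a b : R) :
  a <= b -> cnbhd z (fun y => rcont (Phi y)) -> rcont dPhi ->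
  (forall e, 0 < e -> exists d, 0 < d /\ forall y, Cmod (y - z) < d -> forall t, a <= t <= b ->
    Cmod (Phi y t - Phi z t - (y - z) * dPhi t) <= e * Cmod (y - z)) ->
  cderiv (fun y => CInt (Phi y) a b) z (CInt dPhi a b).
Proof.
  intros hab [d0 [hd0 Hc]] Hd H. apply cderiv_eps. intros e he.
  assert (hz : rcont (Phi z)) by (apply Hc; rewrite Cmod_minus_diag; lra).
  set (e' := e / (2 * (b - a) + 1)).
  assert (he' : 0 < e') by (apply Rdiv_lt_0_compat; lra).
  destruct (H e' he') as [d [hd Hd']]. exists (Rmin d d0). split; [now apply Rmin_pos|].
  intros y hy. pose proof (Rmin_l d d0). pose proof (Rmin_r d d0).
  assert (hy' : rcont (Phi y)) by (apply Hc; lra).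
  rewrite <- CInt_scal by exact Hd.
  assert (h2 : rcont (fun t => (y - z) * dPhi t)%C) by (apply rcont_mult; [apply rcont_const|exact Hd]).
  assert (h3 : rcont (fun t => Phi y t - Phi z t)%C) by (now apply rcont_minus).
  rewrite <- CInt_minus by auto. rewrite <- (CInt_minus (fun t => Phi y t - Phi z t)%C) by auto.
  eapply Rle_trans; [apply (CInt_bound _ a b (e' * Cmod (y - z)))|].
  - now apply rcont_minus.
  - exact hab.
  - intros t ht. apply Hd'; [lra|exact ht].
  - apply Rle_trans with (e' * (2 * (b - a) + 1) * Cmod (y - z)).
    + pose proof (Cmod_ge_0 (y - z)). assert (0 <= e' * Cmod (y - z)) by (apply Rmult_le_pos; lra). nra.
    + right. unfold e'. field. lra.
Qed.

(** The derivative is only asked to vanish on the segment from 0 to z, so that the lemma applies to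
    functions controlled merely on a disc, such as [kernel]. *)
Lemma cderiv_zero_const (f : C -> C) (z : C) :
  (forall t, 0 <= t <= 1 -> cderiv f (RtoC t * z)%C 0) -> f z = f 0.
Proof.
  intros H.
  assert (Hd : forall t, 0 <= t <= 1 -> rderiv (fun t => f (RtoC t * z)%C) t 0).
  { intros t ht. apply (rderiv_val _ _ (1 * (1 * z + RtoC t * 0) * 0)%C); [ring|].
    apply (rderiv_comp f (fun t => RtoC t * z)%C); [now apply H|].
    apply (rderiv_comp (fun y => y * z)%C RtoC); [|apply rderiv_RtoC].
    apply (cderiv_mult (fun y => y) (fun _ => z)); [apply cderiv_id|apply cderiv_const]. }
  assert (E : f (RtoC 0 * z)%C = f (RtoC 1 * z)%C).
  { assert (E1 := eq_is_derive (V := R_NormedModule) (fun t => Re (f (RtoC t * z)%C)) 0 1).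
    assert (E2 := eq_is_derive (V := R_NormedModule) (fun t => Im (f (RtoC t * z)%C)) 0 1).
    assert (h01 : 0 < 1) by lra.
    specialize (E1 (fun t ht => proj1 (proj1 (rderiv_Re_Im _ _ _) (Hd t ht))) h01).
    specialize (E2 (fun t ht => proj2 (proj1 (rderiv_Re_Im _ _ _) (Hd t ht))) h01).
    cbv beta in E1, E2.
    rewrite (surjective_pairing (f (RtoC 0 * z)%C)), (surjective_pairing (f (RtoC 1 * z)%C)).
    unfold Re, Im in *. now rewrite E1, E2. }
  replace (RtoC 0 * z)%C with (RtoC 0) in E by ring. replace (RtoC 1 * z)%C with z in E by ring.
  now symmetry.
Qed.

Lemma rcont_bounded (f : R -> C) (a b : R) : rcont f ->
  exists M, 0 <= M /\ forall t, a <= t <= b -> Cmod (f t) <= M.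
Proof.
  intros Hf.
  destruct (bounded_continuity (V := R_NormedModule) (fun t => Re (f t)) a b) as [M1 H1].
  { intros t _. now apply rcont_Re. }
  destruct (bounded_continuity (V := R_NormedModule) (fun t => Im (f t)) a b) as [M2 H2].
  { intros t _. now apply rcont_Im. }
  exists (Rabs M1 + Rabs M2). split; [pose proof (Rabs_pos M1); pose proof (Rabs_pos M2); lra|].
  intros t ht. eapply Rle_trans; [apply Cmod_le_Re_Im|].
  specialize (H1 t ht). specialize (H2 t ht).
  change (Rabs (Re (f t)) < M1) in H1. change (Rabs (Im (f t)) < M2) in H2.
  pose proof (Rle_abs M1). pose proof (Rle_abs M2). lra.
Qed.

(** Uniform continuity at the points of a compact arc; the second point u may lie off the arc. *)
Lemma ccont_uniform_along (f : C -> C) (g : R -> C) (a b : R) : ccont f -> rcont g ->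
  forall e, 0 < e -> exists d, 0 < d /\
    forall t u, a <= t <= b -> Cmod (u - g t) < d -> Cmod (f u - f (g t)) < e.
Proof.
  intros Hf Hg e he. assert (he2 : 0 < e / 2) by lra.
  assert (H : forall t, exists d : posreal, forall s u,
    Rabs (s - t) < d -> Cmod (u - g s) < d -> Cmod (f u - f (g s)) < e).
  { intros t. destruct (Hf (g t) _ he2) as [d [hd Hd]].
    assert (hd2 : 0 < d / 2) by lra.
    destruct (Hg t (d / 2) hd2) as [d' Hd'].
    exists (mkposreal _ (Rmin_pos _ _ hd2 (cond_pos d'))). simpl. intros s u hs hu.
    pose proof (Rmin_l (d / 2) d'). pose proof (Rmin_r (d / 2) d').
    assert (h1 : Cmod (g s - g t) < d / 2) by (apply Hd'; change (Rabs (s - t) < d'); lra).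
    assert (h2 := Cmod_minus_trans u (g s) (g t)).
    assert (h3 := Cmod_minus_trans (f u) (f (g t)) (f (g s))).
    rewrite (Cmod_minus_comm (f (g t))) in h3.
    assert (h4 := Hd u ltac:(lra)). assert (h5 := Hd (g s) ltac:(lra)). lra. }
  (* Compactness of [a, b] in gauge form: each t is within [gauge s] of some s whose gauge is at
     least a common d. It is stated with a double negation, hence the classical step below. *)
  set (gauge := fun t => proj1_sig (constructive_indefinite_description _ (H t))).
  destruct (compactness_value_1d a b gauge) as [d Hd].
  exists d. split; [apply cond_pos|]. intros t u ht hu.
  apply NNPP. intros hn. apply (Hd t ht). intros [s [hs [h1 h2]]]. apply hn.
  unfold gauge in h1, h2. destruct constructive_indefinite_description as [d' Hd']. simpl in *.
  apply Hd'; [exact h1|lra].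
Qed.

(** The strict derivative: both points vary, so a derivative at the single point z gives Lipschitz
    and injectivity estimates on a whole neighbourhood. *)
Definition sderiv (f : C -> C) (z l : C) : Prop :=
  forall e, 0 < e -> exists d, 0 < d /\ forall x y, Cmod (x - z) < d -> Cmod (y - z) < d ->
    Cmod (f x - f y - (x - y) * l) <= e * Cmod (x - y).

Lemma sderiv_cderiv (f : C -> C) (z l : C) : sderiv f z l -> cderiv f z l.
Proof.
  intros H. apply cderiv_eps. intros e he. destruct (H e he) as [d [hd Hd]].
  exists d. split; [exact hd|]. intros y hy. apply Hd; [exact hy|]. rewrite Cmod_minus_diag; lra.
Qed.

(** The Cauchy transform of a density a on the circle. The density f(zeta) zeta stands for f(zeta) d
    zeta / i and reproduces 2 pi f. *)
Definition kernel (a : R -> C) (r : R) (z : C) : C :=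
  CInt (fun t => a t / (circ r t - z))%C 0 (2 * PI).

Lemma Cmod_inv_le (z : C) (m : R) : 0 < m -> m <= Cmod z -> Cmod (/ z) <= / m.
Proof.
  intros hm h. rewrite Cmod_inv by (apply Cmod_gt_0; lra). now apply Rinv_le_contravar.
Qed.

Lemma rcont_kernel (a : R -> C) (r : R) (z : C) : rcont a -> Cmod z < r ->
  rcont (fun t => a t / (circ r t - z))%C.
Proof.
  intros Ha hz. apply rcont_div; [exact Ha| |].
  - apply rcont_minus; [apply rcont_circ|apply rcont_const].
  - intros t. now apply circ_neq.
Qed.

(** Let u, v, w be the reciprocals of zeta - x, zeta - y, zeta - z. Then u - v - (x - y) w^2 = (x -
    y) ((y - z) u v w + (x - z) u w^2), and all three are at most q when x and y stay within half
    the distance from z to the circle. *)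
Lemma kernel_sderiv (a : R -> C) (r : R) (z : C) : rcont a -> Cmod z < r ->
  sderiv (kernel a r) z (kernel (fun t => a t / (circ r t - z))%C r z).
Proof.
  intros Ha hz e he.
  destruct (rcont_bounded a 0 (2 * PI) Ha) as [M [hM HM]].
  assert (hpi := PI_RGT_0). pose proof (Cmod_ge_0 z) as hz0.
  set (q := / ((r - Cmod z) / 2)).
  assert (hq : 0 < q) by (apply Rinv_0_lt_compat; lra).
  (* The product of the factor 2 of [CInt_bound], the length 2 pi, the bound M of the density and 2
     q^3 from the two summands; the 1 makes A positive. *)
  set (A := 8 * PI * M * (q * q * q) + 1).
  assert (hq3 : 0 < q * q * q) by (repeat apply Rmult_lt_0_compat; auto).
  assert (hA : 0 < A).
  { unfold A. assert (0 <= 8 * PI * M * (q * q * q)) by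
      (apply Rmult_le_pos; [apply Rmult_le_pos; [lra|exact hM]|lra]). lra. }
  set (d := Rmin ((r - Cmod z) / 2) (e / A)).
  assert (hd : 0 < d) by (apply Rmin_pos; [lra|now apply Rdiv_lt_0_compat]).
  assert (hd1 : d <= (r - Cmod z) / 2) by apply Rmin_l.
  assert (hd2 : d <= e / A) by apply Rmin_r.
  exists d. split; [exact hd|]. intros x y hx hy.
  assert (hxr : Cmod x <= Cmod z + Cmod (x - z)).
  { replace x with (z + (x - z))%C at 1 by ring. apply Cmod_triangle. }
  assert (hyr : Cmod y <= Cmod z + Cmod (y - z)).
  { replace y with (z + (y - z))%C at 1 by ring. apply Cmod_triangle. }
  assert (kx := rcont_kernel a r x Ha ltac:(lra)). assert (ky := rcont_kernel a r y Ha ltac:(lra)).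
  assert (kz := rcont_kernel a r z Ha hz). assert (kz2 := rcont_kernel _ r z kz hz).
  unfold kernel.
  rewrite <- CInt_scal by exact kz2. rewrite <- CInt_minus by auto.
  rewrite <- (CInt_minus (fun t => a t / (circ r t - x) - a t / (circ r t - y))%C).
  2:{ now apply rcont_minus. }
  2:{ apply rcont_mult; [apply rcont_const|exact kz2]. }
  eapply Rle_trans; [apply (CInt_bound _ 0 (2 * PI) (M * Cmod (x - y) * (2 * d * (q * q * q))))|].
  - apply rcont_minus; [now apply rcont_minus|]. apply rcont_mult; [apply rcont_const|exact kz2].
  - lra.
  - intros t ht.
    assert (nx := circ_neq r t x ltac:(lra)). assert (ny := circ_neq r t y ltac:(lra)).
    assert (nz := circ_neq r t z hz).
    assert (gx := circ_minus_ge r t x ltac:(lra)). assert (gy := circ_minus_ge r t y ltac:(lra)).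
    assert (gz := circ_minus_ge r t z ltac:(lra)).
    assert (ux := Cmod_inv_le (circ r t - x) ((r - Cmod z) / 2) ltac:(lra) ltac:(lra)).
    assert (uy := Cmod_inv_le (circ r t - y) ((r - Cmod z) / 2) ltac:(lra) ltac:(lra)).
    assert (uz := Cmod_inv_le (circ r t - z) ((r - Cmod z) / 2) ltac:(lra) ltac:(lra)).
    fold q in ux, uy, uz.
    set (u := (/ (circ r t - x))%C) in *. set (v := (/ (circ r t - y))%C) in *.
    set (w := (/ (circ r t - z))%C) in *.
    replace (a t / (circ r t - x) - a t / (circ r t - y) - (x - y) * (a t / (circ r t - z) / (circ r t - z)))%C
      with (a t * (x - y) * ((y - z) * (u * v * w) + (x - z) * (u * w * w)))%C
      by (unfold u, v, w; field; auto).
    rewrite !Cmod_mult.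
    apply Rmult_le_compat.
    + apply Rmult_le_pos; apply Cmod_ge_0.
    + apply Cmod_ge_0.
    + apply Rmult_le_compat_r; [apply Cmod_ge_0|now apply HM].
    + eapply Rle_trans; [apply Cmod_triangle|]. rewrite !Cmod_mult.
      pose proof (Cmod_ge_0 u); pose proof (Cmod_ge_0 v); pose proof (Cmod_ge_0 w).
      pose proof (Cmod_ge_0 (x - z)); pose proof (Cmod_ge_0 (y - z)).
      assert (Cmod u * Cmod v * Cmod w <= q * q * q).
      { repeat apply Rmult_le_compat; auto; apply Rmult_le_pos; auto. }
      assert (Cmod u * Cmod w * Cmod w <= q * q * q).
      { repeat apply Rmult_le_compat; auto; apply Rmult_le_pos; auto. }
      assert (Cmod (y - z) * (Cmod u * Cmod v * Cmod w) <= d * (q * q * q)).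
      { apply Rmult_le_compat; try lra. repeat apply Rmult_le_pos; auto. }
      assert (Cmod (x - z) * (Cmod u * Cmod w * Cmod w) <= d * (q * q * q)).
      { apply Rmult_le_compat; try lra. repeat apply Rmult_le_pos; auto. }
      lra.
  - replace (2 * ((2 * PI - 0) * (M * Cmod (x - y) * (2 * d * (q * q * q)))))
      with ((8 * PI * M * (q * q * q)) * d * Cmod (x - y)) by ring.
    apply Rmult_le_compat_r; [apply Cmod_ge_0|].
    apply Rle_trans with (A * d); [apply Rmult_le_compat_r; unfold A; lra|].
    apply Rle_trans with (A * (e / A)); [apply Rmult_le_compat_l; lra|]. right; field; lra.
Qed.

Lemma Cmod_scal_le (t : R) (z : C) : 0 <= t <= 1 -> Cmod (RtoC t * z) <= Cmod z.
Proof.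
  intros ht. rewrite Cmod_mult, Cmod_R, Rabs_pos_eq by lra. pose proof (Cmod_ge_0 z). nra.
Qed.

(** The derivative in y is the loop integral of 1 / (zeta - y)^2, which has the primitive -1 / (zeta
    - y). The transform is therefore constant along the segment from 0 to z, and at 0 its integrand
    is 1. *)
Lemma kernel_circ (r : R) (z : C) : Cmod z < r -> kernel (circ r) r z = RtoC (2 * PI).
Proof.
  intros hz. pose proof (Cmod_ge_0 z) as hz0.
  rewrite (cderiv_zero_const (kernel (circ r) r) z).
  - unfold kernel. rewrite (CInt_ext _ (fun _ => RtoC 1)).
    + rewrite CInt_const, Rminus_0_r. ring.
    + intros t. assert (n := circ_neq r t 0 ltac:(rewrite Cmod_0; lra)).
      replace (circ r t - 0)%C with (circ r t) in * by ring. now field.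
  - intros t ht. assert (h := Cmod_scal_le t z ht). set (y := (RtoC t * z)%C) in *.
    assert (hy : Cmod y < r) by lra.
    apply (cderiv_val _ _ (kernel (fun t => circ r t / (circ r t - y))%C r y)).
    2:{ apply sderiv_cderiv, kernel_sderiv; [apply rcont_circ|exact hy]. }
    unfold kernel.
    rewrite (CInt_ext _ (fun s => circ r s * (/ ((circ r s - y) * (circ r s - y))))%C).
    2:{ intros s. field. now apply circ_neq. }
    apply (CInt_loop r (fun u => -1 * / (u - y))%C).
    + intros s. assert (n := circ_neq r s y hy).
      apply (cderiv_val _ _ (-1 * ((1 - 0) * - / ((circ r s - y) * (circ r s - y))))%C); [now field|].
      apply cderiv_scal. apply (cderiv_comp (fun u => / u)%C (fun u => u - y)%C).
      * now apply cderiv_inv.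
      * apply cderiv_minus; [apply cderiv_id|apply cderiv_const].
    + intros s. apply clim_inv; [apply _|apply Cmult_neq_0; now apply circ_neq|].
      assert (hc : rcont (fun s => circ r s - y)%C) by (apply rcont_minus; [apply rcont_circ|apply rcont_const]).
      apply clim_mult; [apply _| |]; apply hc.
Qed.

(** The s-derivative of F (p s t) w t is zeta f (p s t). Its integral over the circle vanishes: for
    s <> 0 because u -> F (z + s (u - z)) / s is a primitive of f (z + s (u - z)), for s = 0 because
    zeta itself integrates to 0. Comparing [G 1] with [G 0] and evaluating the integral of [w] by
    [kernel_circ] gives the formula. *)
Lemma cauchy_formula_primitive (F f : C -> C) (r : R) (z : C) :
  (forall y, cderiv F y (f y)) -> ccont f -> Cmod z < r ->
  (RtoC (2 * PI) * F z)%C = kernel (fun t => F (circ r t) * circ r t)%C r z.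
Proof.
  intros HF Hf hz. pose proof (Cmod_ge_0 z) as hz0. pose proof PI_RGT_0 as hpi.
  assert (HFc : ccont F) by (intros y; exact (cderiv_cont _ _ _ (HF y))).
  set (p := fun s t => (z + s * (circ r t - z))%C).
  assert (Hp : forall s, rcont (p s)).
  { intros s. apply rcont_plus; [apply rcont_const|]. apply rcont_mult; [apply rcont_const|].
    apply rcont_minus; [apply rcont_circ|apply rcont_const]. }
  set (w := fun t => (circ r t / (circ r t - z))%C).
  assert (Hw : rcont w) by (apply rcont_kernel; [apply rcont_circ|exact hz]).
  (* The integrals of F over the circles shrinking from |y| = r to the point z. *)
  set (G := fun s => CInt (fun t => F (p s t) * w t)%C 0 (2 * PI)).
  assert (HG : forall s, cderiv G s 0).
  { intros s.
    apply (cderiv_val _ _ (CInt (fun t => circ r t * f (p s t))%C 0 (2 * PI))).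
    - destruct (excluded_middle_informative (s = 0)) as [->|n].
      + rewrite (CInt_ext _ (fun t => f z * circ r t)%C).
        * rewrite CInt_scal, CInt_circ by apply rcont_circ. ring.
        * intros t. unfold p. replace (z + 0 * (circ r t - z))%C with z by ring. ring.
      + apply (CInt_loop r (fun u => / s * F (z + s * (u - z)))%C).
        * intros t. apply (cderiv_val _ _ (/ s * ((0 + s * (1 - 0)) * f (p s t)))%C); [now field|].
          apply cderiv_scal. apply (cderiv_comp F (fun u => z + s * (u - z))%C); [apply HF|].
          apply (cderiv_plus (fun _ => z) (fun u => s * (u - z))%C); [apply cderiv_const|].
          apply cderiv_scal, cderiv_minus; [apply cderiv_id|apply cderiv_const].
        * apply rcont_comp; [exact Hf|apply Hp].
    - apply (cderiv_CInt (fun s t => F (p s t) * w t)%C).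
      + lra.
      + apply filter_forall. intros y. apply rcont_mult; [|exact Hw]. apply rcont_comp; [exact HFc|apply Hp].
      + apply rcont_mult; [apply rcont_circ|]. apply rcont_comp; [exact Hf|apply Hp].
      + intros e he.
        assert (he' : 0 < e / (2 * r)) by (apply Rdiv_lt_0_compat; lra).
        (* The increment of F is a segment integral of f; uniform continuity of f along the curve
           [p s] makes the remainder uniform in t. As |zeta - z| <= 2 r, a step y - s moves the
           curve by at most 2 r |y - s|. *)
        destruct (ccont_uniform_along f (p s) 0 (2 * PI) Hf (Hp s) _ he') as [d [hd Hd]].
        exists (d / (2 * r)). split; [apply Rdiv_lt_0_compat; lra|]. intros y hy t ht.
        assert (n := circ_neq r t z hz).
        set (k := ((y - s) * (circ r t - z))%C).
        assert (Ek : p y t = (p s t + k)%C) by (unfold p, k; ring).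
        assert (hk : Cmod k < d).
        { unfold k. rewrite Cmod_mult.
          assert (h1 : Cmod (circ r t - z) <= 2 * r).
          { eapply Rle_trans; [apply Cmod_triangle_minus|]. rewrite Cmod_circ by lra. lra. }
          apply Rle_lt_trans with (Cmod (y - s) * (2 * r)).
          - apply Rmult_le_compat_l; [apply Cmod_ge_0|exact h1].
          - apply Rmult_lt_compat_r with (r := 2 * r) in hy; [|lra].
            replace (d / (2 * r) * (2 * r)) with d in hy by (field; lra). exact hy. }
        assert (Eseg := seg_deriv F f (p s t) (p y t) HF Hf).
        replace (F (p y t) * w t - F (p s t) * w t - (y - s) * (circ r t * f (p s t)))%C
          with ((seg f (p s t) (p y t) - seg (fun _ => f (p s t)) (p s t) (p y t)) * w t)%C.
        2:{ rewrite Eseg, seg_const, Ek. unfold k, w. now field. }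
        assert (Hk : ccont (fun _ => f (p s t))) by (intros x; apply clim_const, _).
        rewrite <- seg_minus by auto. rewrite Cmod_mult.
        apply Rle_trans with (2 * (Cmod (p y t - p s t) * (e / (2 * r))) * Cmod (w t)).
        * apply Rmult_le_compat_r; [apply Cmod_ge_0|]. apply seg_bound.
          -- intros x. apply clim_minus; [apply _|apply Hf|apply Hk].
          -- intros x hx. apply Rlt_le, Hd; [exact ht|].
             rewrite Ek. replace (p s t + RtoC x * (p s t + k - p s t) - p s t)%C with (RtoC x * k)%C by ring.
             eapply Rle_lt_trans; [now apply Cmod_scal_le|exact hk].
        * rewrite Ek. replace (p s t + k - p s t)%C with k by ring.
          replace (2 * (Cmod k * (e / (2 * r))) * Cmod (w t)) with (e / r * Cmod (k * w t)).
          2:{ rewrite Cmod_mult. field. lra. }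
          replace (k * w t)%C with ((y - s) * circ r t)%C by (unfold k, w; now field).
          rewrite Cmod_mult, Cmod_circ by lra. right. field. lra. }
  assert (E := cderiv_zero_const G 1 (fun t _ => HG _)).
  unfold G in E.
  rewrite (CInt_ext (fun t => F (p 0 t) * w t)%C (fun t => F z * w t)%C) in E.
  2:{ intros t. unfold p. now replace (z + 0 * (circ r t - z))%C with z by ring. }
  rewrite CInt_scal in E by exact Hw.
  assert (EJ := kernel_circ r z hz). unfold kernel in EJ. fold w in EJ. rewrite EJ in E.
  rewrite Cmult_comm, <- E. unfold kernel. apply CInt_ext. intros t. unfold p, w.
  replace (z + 1 * (circ r t - z))%C with (circ r t) by ring. unfold Cdiv. ring.
Qed.

(** Differentiating the formula for a primitive F in z gives 2 pi f z as the integral of F zeta /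
    (zeta - z)^2. The derivative of F u / (u - z) in u integrates to zero around the circle, which
    moves the derivative from the kernel onto F. *)
Lemma cauchy_formula (f : C -> C) (r : R) (z : C) : centire f -> Cmod z < r ->
  (RtoC (2 * PI) * f z)%C = kernel (fun t => f (circ r t) * circ r t)%C r z.
Proof.
  intros Hf hz. assert (Hc := centire_cont f Hf). pose proof (Cmod_ge_0 z) as hz0.
  destruct (centire_primitive f Hf) as [F HF].
  assert (HFc : ccont F) by (intros y; exact (cderiv_cont _ _ _ (HF y))).
  set (a := fun t => (F (circ r t) * circ r t)%C).
  assert (Ha : rcont a) by (apply rcont_mult; [apply rcont_comp; [exact HFc|]|]; apply rcont_circ).
  assert (Haz := rcont_kernel a r z Ha hz). assert (Haz2 := rcont_kernel _ r z Haz hz).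
  set (b := fun t => (f (circ r t) * circ r t)%C).
  assert (Hb : rcont b) by (apply rcont_mult; [apply rcont_comp; [exact Hc|]|]; apply rcont_circ).
  assert (Hbz := rcont_kernel b r z Hb hz).
  assert (E : (RtoC (2 * PI) * f z)%C = kernel (fun t => a t / (circ r t - z))%C r z).
  { apply (cderiv_unique (kernel a r) z).
    - apply (cderiv_ext_loc (fun y => RtoC (2 * PI) * F y)%C).
      + exists (r - Cmod z). split; [lra|]. intros y hy. apply (cauchy_formula_primitive F f); auto.
        assert (h := Cmod_triangle (y - z) z). replace (y - z + z)%C with y in h by ring. lra.
      + apply cderiv_scal, HF.
    - now apply sderiv_cderiv, kernel_sderiv. }
  rewrite E. unfold kernel.
  (* Integration by parts. *)
  assert (L : CInt (fun t => circ r t * (f (circ r t) / (circ r t - z)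
     - F (circ r t) / (circ r t - z) / (circ r t - z)))%C 0 (2 * PI) = 0).
  { apply (CInt_loop r (fun u => F u * / (u - z))%C).
    - intros t. assert (n := circ_neq r t z hz).
      apply (cderiv_val _ _ (f (circ r t) * / (circ r t - z)
        + F (circ r t) * ((1 - 0) * - / ((circ r t - z) * (circ r t - z))))%C); [now field|].
      apply (cderiv_mult F (fun u => / (u - z))%C); [apply HF|].
      apply (cderiv_comp (fun u => / u)%C (fun u => u - z)%C); [now apply cderiv_inv|].
      apply cderiv_minus; [apply cderiv_id|apply cderiv_const].
    - assert (H1 : rcont (fun t => f (circ r t))) by (apply rcont_comp; [exact Hc|apply rcont_circ]).
      assert (H2 : rcont (fun t => F (circ r t))) by (apply rcont_comp; [exact HFc|apply rcont_circ]).
      apply rcont_minus; repeat (apply rcont_kernel; [|exact hz]); auto. }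
  rewrite (CInt_ext _ (fun t => b t / (circ r t - z) - a t / (circ r t - z) / (circ r t - z))%C) in L.
  2:{ intros t. unfold a, b, Cdiv. ring. }
  rewrite CInt_minus in L by auto.
  match goal with |- ?u = ?v => replace v with ((v - u) + u)%C by ring end.
  rewrite L. ring.
Qed.

(** * Local structure of entire functions *)

Lemma RtoC_2PI_neq : RtoC (2 * PI) <> 0.
Proof. apply RtoC_neq_0. pose proof PI_RGT_0. lra. Qed.

Lemma cderiv_translate (f : C -> C) (w u l : C) :
  cderiv f (w + u)%C l -> cderiv (fun y => f (w + y)%C) u l.
Proof.
  intros H. apply (cderiv_val _ _ ((0 + 1) * l)%C); [ring|].
  apply (cderiv_comp f (fun y => w + y)%C); [exact H|].
  apply (cderiv_plus (fun _ => w) (fun y => y)); [apply cderiv_const|apply cderiv_id].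
Qed.

Lemma centire_translate (f : C -> C) (w : C) : centire f -> centire (fun y => f (w + y)%C).
Proof. intros H u. destruct (H (w + u)%C) as [l Hl]. exists l. now apply cderiv_translate. Qed.

Lemma sderiv_scal (c : C) (f : C -> C) (z l : C) : sderiv f z l -> sderiv (fun y => c * f y)%C z (c * l)%C.
Proof.
  intros H e he. pose proof (Cmod_ge_0 c) as hc.
  assert (he' : 0 < e / (Cmod c + 1)) by (apply Rdiv_lt_0_compat; lra).
  destruct (H _ he') as [d [hd Hd]]. exists d. split; [exact hd|]. intros x y hx hy.
  replace (c * f x - c * f y - (x - y) * (c * l))%C with (c * (f x - f y - (x - y) * l))%C by ring.
  rewrite Cmod_mult. specialize (Hd x y hx hy).
  apply Rle_trans with (Cmod c * (e / (Cmod c + 1) * Cmod (x - y))); [now apply Rmult_le_compat_l|].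
  replace (Cmod c * (e / (Cmod c + 1) * Cmod (x - y))) with (Cmod c * (e / (Cmod c + 1)) * Cmod (x - y)) by ring.
  apply Rmult_le_compat_r; [apply Cmod_ge_0|].
  apply Rle_trans with ((Cmod c + 1) * (e / (Cmod c + 1))); [apply Rmult_le_compat_r; lra|].
  right; field; lra.
Qed.

Lemma rcont_on_circ (f : C -> C) (r : R) : ccont f -> rcont (fun t => f (circ r t)).
Proof. intros H. apply rcont_comp; [exact H|apply rcont_circ]. Qed.

(** On the unit disc around w, f is a Cauchy transform divided by 2 pi, hence strictly
    differentiable; uniqueness of derivatives identifies the value. *)
Lemma centire_sderiv (f : C -> C) (w l : C) : centire f -> cderiv f w l -> sderiv f w l.
Proof.
  intros Hf Hl.
  set (g := fun y => f (w + y)%C). assert (Hg : centire g) by now apply centire_translate.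
  set (b := fun t => (g (circ 1 t) * circ 1 t)%C).
  assert (Hb : rcont b).
  { apply rcont_mult; [|apply rcont_circ]. now apply rcont_on_circ, centire_cont. }
  assert (h0 : Cmod 0 < 1) by (rewrite Cmod_0; lra).
  assert (n := RtoC_2PI_neq).
  assert (S := sderiv_scal (/ RtoC (2 * PI)) _ _ _ (kernel_sderiv b 1 0 Hb h0)).
  set (m := (/ RtoC (2 * PI) * kernel (fun t => b t / (circ 1 t - 0)) 1 0)%C) in S.
  assert (Eg : forall x, Cmod x < 1 -> (/ RtoC (2 * PI) * kernel b 1 x)%C = g x).
  { intros x hx. unfold b. rewrite <- (cauchy_formula g 1 x Hg hx). now field. }
  assert (Sg : sderiv g 0 m).
  { intros e he. destruct (S e he) as [d [hd Hd]]. exists (Rmin d 1).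
    split; [apply Rmin_pos; lra|]. intros x y hx hy.
    pose proof (Rmin_l d 1). pose proof (Rmin_r d 1).
    specialize (Hd x y ltac:(lra) ltac:(lra)). rewrite !Eg in Hd; [exact Hd| |].
    - replace (y - 0)%C with y in hy by ring. lra.
    - replace (x - 0)%C with x in hx by ring. lra. }
  assert (E : l = m).
  { apply (cderiv_unique g 0); [|now apply sderiv_cderiv].
    apply cderiv_translate. now replace (w + 0)%C with w by ring. }
  subst m. rewrite <- E in Sg.
  intros e he. destruct (Sg e he) as [d [hd Hd]]. exists d. split; [exact hd|]. intros x y hx hy.
  specialize (Hd (x - w)%C (y - w)%C). unfold g in Hd.
  replace (x - w - 0)%C with (x - w)%C in Hd by ring. replace (y - w - 0)%C with (y - w)%C in Hd by ring.
  replace (w + (x - w))%C with x in Hd by ring. replace (w + (y - w))%C with y in Hd by ring.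
  replace (x - w - (y - w))%C with (x - y)%C in Hd by ring. auto.
Qed.

(** A removable singularity: subtracting Cauchy's formulas at z and at 0 leaves z times the Cauchy
    transform of f, because zeta / (zeta - z) - 1 = z / (zeta - z). Near 0 the quotient is this
    transform, and elsewhere the quotient rule applies. *)
Lemma centire_divided_difference (f : C -> C) : centire f ->
  exists g, centire g /\ forall z, f z = (f 0 + z * g z)%C.
Proof.
  intros Hf. assert (Hc := centire_cont f Hf). assert (n := RtoC_2PI_neq).
  set (b := fun t => f (circ 1 t)).
  assert (Hb : rcont b) by now apply rcont_on_circ.
  set (k := fun z => (/ RtoC (2 * PI) * kernel b 1 z)%C).
  set (g := fun z : C => if excluded_middle_informative (z = 0) then k 0 else ((f z - f 0) / z)%C).
  assert (Hg : forall z, f z = (f 0 + z * g z)%C).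
  { intros z. unfold g. destruct excluded_middle_informative as [->|h]; [ring|now field]. }
  assert (Hk : forall z, Cmod z < 1 -> f z = (f 0 + z * k z)%C).
  { intros z hz. assert (h0 : Cmod 0 < 1) by (rewrite Cmod_0; lra).
    assert (E := cauchy_formula f 1 z Hf hz). assert (E0 := cauchy_formula f 1 0 Hf h0).
    assert (Hbc : rcont (fun t => f (circ 1 t) * circ 1 t)%C) by (apply rcont_mult; [exact Hb|apply rcont_circ]).
    assert (D : (RtoC (2 * PI) * f z - RtoC (2 * PI) * f 0)%C = (z * kernel b 1 z)%C).
    { rewrite E, E0. unfold kernel. rewrite <- CInt_minus, <- CInt_scal.
      - apply CInt_ext. intros t. unfold b.
        assert (n1 := circ_neq 1 t z hz). assert (n2 := circ_neq 1 t 0 h0).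
        replace (circ 1 t - 0)%C with (circ 1 t) in * by ring. field. auto.
      - now apply rcont_kernel.
      - now apply rcont_kernel.
      - now apply rcont_kernel. }
    unfold k. replace (z * (/ RtoC (2 * PI) * kernel b 1 z))%C with (/ RtoC (2 * PI) * (z * kernel b 1 z))%C by ring.
    rewrite <- D. now field. }
  exists g. split; [|exact Hg]. intros z.
  destruct (excluded_middle_informative (z = 0)) as [->|h].
  - exists (/ RtoC (2 * PI) * kernel (fun t => b t / (circ 1 t - 0)) 1 0)%C.
    apply (cderiv_ext_loc k).
    + exists 1. split; [lra|]. intros y hy. replace (y - 0)%C with y in hy by ring.
      destruct (excluded_middle_informative (y = 0)) as [->|h].
      * unfold g. destruct excluded_middle_informative; tauto.
      * assert (E : (y * k y)%C = (y * g y)%C).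
        { replace (y * k y)%C with ((f 0 + y * k y) - f 0)%C by ring.
          rewrite <- Hk by exact hy. rewrite Hg. ring. }
        replace (k y) with (/ y * (y * k y))%C by now field. rewrite E. now field.
    + apply cderiv_scal. apply sderiv_cderiv, kernel_sderiv; [exact Hb|]. rewrite Cmod_0; lra.
  - destruct (Hf z) as [l Hl]. eexists.
    apply (cderiv_ext_loc (fun y => (f y - f 0) * / y)%C).
    + generalize (cnbhd_neq z 0 h). apply filter_imp. intros y hy. unfold g.
      destruct excluded_middle_informative; [tauto|reflexivity].
    + apply (cderiv_mult (fun y => f y - f 0)%C (fun y => / y)%C).
      * apply cderiv_minus; [exact Hl|apply cderiv_const].
      * now apply cderiv_inv.
Qed.

(** For |z| <= r / 2 the denominator is at least r / 2, so the integrand is at most 2 M;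
    [CInt_bound] doubles this. *)
Lemma cauchy_estimate (f : C -> C) (r M : R) (z : C) : centire f -> 0 < r ->
  (forall t, 0 <= t <= 2 * PI -> Cmod (f (circ r t)) <= M) -> Cmod z <= r / 2 -> Cmod (f z) <= 4 * M.
Proof.
  intros Hf hr HM hz. pose proof PI_RGT_0 as hpi. assert (Hc := centire_cont f Hf).
  assert (hz' : Cmod z < r) by lra.
  assert (hM : 0 <= M).
  { eapply Rle_trans; [apply Cmod_ge_0|apply (HM 0)]. lra. }
  assert (E := cauchy_formula f r z Hf hz').
  apply Rmult_le_reg_l with (2 * PI); [lra|].
  replace (2 * PI * Cmod (f z)) with (Cmod (RtoC (2 * PI) * f z)).
  2:{ rewrite Cmod_mult, Cmod_R, Rabs_pos_eq; lra. }
  rewrite E. unfold kernel. eapply Rle_trans; [apply (CInt_bound _ 0 (2 * PI) (2 * M))|].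
  - apply rcont_kernel; [|exact hz']. apply rcont_mult; [|apply rcont_circ]. now apply rcont_on_circ.
  - lra.
  - intros t ht. assert (n := circ_neq r t z hz').
    assert (g := circ_minus_ge r t z ltac:(lra)).
    unfold Cdiv. rewrite !Cmod_mult, Cmod_circ by lra.
    assert (h := Cmod_inv_le (circ r t - z) (r / 2) ltac:(lra) ltac:(lra)).
    replace (2 * M) with (M * r * / (r / 2)) by (field; lra).
    apply Rmult_le_compat; auto.
    + apply Rmult_le_pos; [apply Cmod_ge_0|lra].
    + apply Cmod_ge_0.
    + apply Rmult_le_compat_r; [lra|]. now apply HM.
  - right; ring.
Qed.

(** If M bounds f - f 0 on the circle of radius r, then g is at most M / r^n there and at most 4 M /
    r^n at z. As |z| <= r / 2, the term z^n g z is at most 4 M / 2^n for every n. *)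
Lemma centire_flat_const (f : C -> C) : centire f ->
  (forall n, exists g, centire g /\ forall z, f z = (f 0 + z ^ n * g z)%C) ->
  forall z, f z = f 0.
Proof.
  intros Hf H z. set (r := 2 * Cmod z + 1). pose proof (Cmod_ge_0 z) as hz.
  assert (hr : 0 < r) by (unfold r; lra).
  destruct (rcont_bounded (fun t => f (circ r t) - f 0)%C 0 (2 * PI)) as [M [hM HM]].
  { apply rcont_minus; [now apply rcont_on_circ, centire_cont|apply rcont_const]. }
  assert (Hn : forall n, Cmod (f z - f 0) <= 4 * M * (1 / 2) ^ n).
  { intros n. destruct (H n) as [g [Hg E]].
    assert (hrn : 0 < r ^ n) by now apply pow_lt.
    assert (hg : Cmod (g z) <= 4 * (M / r ^ n)).
    { apply (cauchy_estimate g r); auto; [|unfold r; lra].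
      intros t ht. apply Rmult_le_reg_l with (r ^ n); [exact hrn|].
      replace (r ^ n * (M / r ^ n)) with M by (field; lra).
      rewrite <- (Cmod_circ r t) at 1 by lra. rewrite <- Cmod_pow, <- Cmod_mult.
      specialize (HM t ht). rewrite (E (circ r t)) in HM.
      now replace (f 0 + circ r t ^ n * g (circ r t) - f 0)%C with (circ r t ^ n * g (circ r t))%C in HM by ring. }
    rewrite (E z). replace (f 0 + z ^ n * g z - f 0)%C with (z ^ n * g z)%C by ring.
    rewrite Cmod_mult, Cmod_pow.
    apply Rle_trans with ((r / 2) ^ n * (4 * (M / r ^ n))).
    - apply Rmult_le_compat; auto; [now apply pow_le|apply Cmod_ge_0|].
      apply pow_incr. unfold r; lra.
    - right. replace (r / 2) with (r * (1 / 2)) by field. rewrite Rpow_mult_distr. field. lra. }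
  assert (E : (f z - f 0)%C = 0).
  { apply Cmod_small_eq_0. intros e he.
    destruct (pow_lt_1_zero (1 / 2)) with (y := e / (4 * M + 1)) as [N HN].
    { rewrite Rabs_pos_eq; lra. }
    { apply Rdiv_lt_0_compat; lra. }
    specialize (HN N (Nat.le_refl N)).
    assert (hp : 0 < (1 / 2) ^ N) by (apply pow_lt; lra).
    rewrite Rabs_pos_eq in HN by lra.
    eapply Rle_trans; [apply (Hn N)|].
    apply Rle_trans with ((4 * M + 1) * (e / (4 * M + 1))); [|right; field; lra].
    apply Rmult_le_compat; lra. }
  replace (f z) with ((f z - f 0) + f 0)%C by ring. rewrite E. ring.
Qed.

(** Dividing by z either stops at a quotient with g 0 <> 0, which supplies c = g 0 after
    normalising, or continues for all n, and then f is constant by [centire_flat_const]. The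
    induction starts at exponent 1, which gives k >= 1. *)
Lemma centire_normal_form_at_0 (f : C -> C) : centire f -> (exists z, f z <> f 0) ->
  exists (k : nat) (c : C) (g : C -> C), (1 <= k)%nat /\ c <> 0 /\ centire g /\ g 0 = 1 /\
    forall u, f u = (f 0 + c * (u ^ k * g u))%C.
Proof.
  intros Hf [z0 hz0]. apply NNPP. intros hn. apply hz0. apply centire_flat_const; [exact Hf|].
  assert (H : forall n, exists g, centire g /\ forall z, f z = (f 0 + z ^ S n * g z)%C).
  { induction n as [|n [g [Hg E]]].
    - destruct (centire_divided_difference f Hf) as [g [Hg E]]. exists g. split; [exact Hg|].
      intros z. rewrite (E z) at 1. rewrite Cpow_S. simpl. ring.
    - destruct (excluded_middle_informative (g 0 = 0)) as [h|h].
      + destruct (centire_divided_difference g Hg) as [g' [Hg' E']]. exists g'. split; [exact Hg'|].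
        intros z. rewrite (E z) at 1. rewrite (E' z), h, !Cpow_S. ring.
      + exfalso. apply hn. exists (S n), (g 0), (fun z => / g 0 * g z)%C.
        split; [lia|]. split; [exact h|]. split; [|split].
        * intros z. destruct (Hg z) as [l Hl]. exists (/ g 0 * l)%C. now apply cderiv_scal.
        * now field.
        * intros u. rewrite (E u) at 1. now field. }
  intros [|n]; [|apply H].
  exists (fun z => f z - f 0)%C. split; [|intros z; simpl; ring].
  intros z. destruct (Hf z) as [l Hl]. exists (l - 0)%C. apply cderiv_minus; [exact Hl|apply cderiv_const].
Qed.

Lemma centire_normal_form (f : C -> C) (w : C) : centire f -> nonconstant f ->
  exists (k : nat) (c : C) (g : C -> C), (1 <= k)%nat /\ c <> 0 /\ centire g /\ g 0 = 1 /\
    forall u, f (w + u)%C = (f w + c * (u ^ k * g u))%C.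
Proof.
  intros Hf [z1 [z2 hz]].
  assert (E0 : (w + 0)%C = w) by ring.
  destruct (centire_normal_form_at_0 (fun u => f (w + u)%C)) as [k [c [g [h1 [h2 [h3 [h4 h5]]]]]]].
  - now apply centire_translate.
  - rewrite E0. apply NNPP. intros hn. apply hz.
    assert (H : forall z, f z = f w).
    { intros z. apply NNPP. intros h. apply hn. exists (z - w)%C.
      now replace (w + (z - w))%C with z by ring. }
    now rewrite !H.
  - exists k, c, g. rewrite E0 in h5. auto.
Qed.

(** * Branches near a point *)

Lemma centire_pow (k : nat) : centire (fun y => y ^ k)%C.
Proof. intros z. eexists. apply cderiv_pow. Qed.

(* After the substitution u = z s, the equation f (w + u) = f (w + z) for
   f (w + u) = f w + c u^k g u reads s^k g (z s) = g z; this blow-up is a small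
   perturbation of s^k = 1 when z is small. *)
Definition blowup (k : nat) (g : C -> C) (z s : C) : C := (s ^ k * g (z * s))%C.

(** The difference splits into s^k (g (z s) - g (z t)), (g (z t) - 1) (s^k - t^k) and the strict
    remainder of s^k. The first is small because g is Lipschitz near 0 and z s - z t = z (s - t),
    the second because z t is near 0. The estimate is uniform in z and includes z = 0. *)
Lemma blowup_strict (k : nat) (g : C -> C) (a : C) (e : R) :
  centire g -> g 0 = 1 -> 0 < e ->
  exists d, 0 < d /\ forall z s t, Cmod z < d -> Cmod (s - a) < d -> Cmod (t - a) < d ->
    Cmod (blowup k g z s - blowup k g z t - (s - t) * (RtoC (INR k) * a ^ (k - 1))) <= e * Cmod (s - t).
Proof.
  intros Hg g0 he. set (l := (RtoC (INR k) * a ^ (k - 1))%C).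
  assert (he3 : 0 < e / 3) by lra.
  destruct (centire_sderiv _ a l (centire_pow k) (cderiv_pow k a) _ he3) as [d1 [hd1 H1]].
  destruct (Hg 0) as [m Hm].
  destruct (centire_sderiv g 0 m Hg Hm 1 Rlt_0_1) as [d2 [hd2 H2]].
  set (A := Cmod a + 1). set (L := Cmod m + 1).
  pose proof (Cmod_ge_0 a); pose proof (Cmod_ge_0 m); pose proof (Cmod_ge_0 l).
  assert (hA : 1 <= A) by (unfold A; lra). assert (hL : 1 <= L) by (unfold L; lra).
  assert (hAk : 0 <= A ^ k) by (apply pow_le; lra).
  assert (HL : forall x y, Cmod x < d2 -> Cmod y < d2 -> Cmod (g x - g y) <= L * Cmod (x - y)).
  { intros x y hx hy. specialize (H2 x y).
    replace (x - 0)%C with x in H2 by ring. replace (y - 0)%C with y in H2 by ring.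
    specialize (H2 hx hy).
    replace (g x - g y)%C with ((g x - g y - (x - y) * m) + (x - y) * m)%C by ring.
    eapply Rle_trans; [apply Cmod_triangle|]. rewrite (Cmod_mult (x - y)). unfold L. lra. }
  (* [A] bounds s and t, [L] is a Lipschitz constant of g near 0, and |l| + e / 3 is one for s^k
     near a. The first two parts together are at most d B |s - t|, which d B <= e / 3 controls. *)
  set (B := A ^ k * L + L * A * (Cmod l + e / 3) + 1).
  assert (hB1 : 0 <= A ^ k * L) by (apply Rmult_le_pos; lra).
  assert (hB2 : 0 <= L * A * (Cmod l + e / 3)) by (apply Rmult_le_pos; [apply Rmult_le_pos|]; lra).
  assert (hB : 0 < B) by (unfold B; lra).
  set (d := Rmin (Rmin 1 d1) (Rmin (d2 / A) (e / (3 * B)))).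
  assert (hd : 0 < d).
  { repeat apply Rmin_pos; try lra; apply Rdiv_lt_0_compat; lra. }
  assert (k1 : d <= 1) by (eapply Rle_trans; [apply Rmin_l|apply Rmin_l]).
  assert (k2 : d <= d1) by (eapply Rle_trans; [apply Rmin_l|apply Rmin_r]).
  assert (k3 : d * A <= d2).
  { assert (h : d <= d2 / A) by (eapply Rle_trans; [apply Rmin_r|apply Rmin_l]).
    apply Rmult_le_compat_r with (r := A) in h; [|lra].
    replace (d2 / A * A) with d2 in h by (field; lra). exact h. }
  assert (k4 : d * B <= e / 3).
  { assert (h : d <= e / (3 * B)) by (eapply Rle_trans; [apply Rmin_r|apply Rmin_r]).
    apply Rmult_le_compat_r with (r := B) in h; [|lra].
    replace (e / (3 * B) * B) with (e / 3) in h by (field; lra). exact h. }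
  clearbody d.
  exists d. split; [exact hd|]. intros z s t hz hs ht.
  assert (bs : Cmod s <= A).
  { assert (h := Cmod_triangle (s - a) a). replace (s - a + a)%C with s in h by ring. unfold A; lra. }
  assert (bt : Cmod t <= A).
  { assert (h := Cmod_triangle (t - a) a). replace (t - a + a)%C with t in h by ring. unfold A; lra. }
  pose proof (Cmod_ge_0 z) as z0; pose proof (Cmod_ge_0 s) as s0; pose proof (Cmod_ge_0 t) as t0.
  assert (zs : Cmod (z * s) < d2).
  { rewrite Cmod_mult. apply Rle_lt_trans with (Cmod z * A); [now apply Rmult_le_compat_l|].
    assert (Cmod z * A < d * A) by (apply Rmult_lt_compat_r; lra). lra. }
  assert (zt : Cmod (z * t) < d2).
  { rewrite Cmod_mult. apply Rle_lt_trans with (Cmod z * A); [now apply Rmult_le_compat_l|].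
    assert (Cmod z * A < d * A) by (apply Rmult_lt_compat_r; lra). lra. }
  assert (hst := HL _ _ zs zt).
  assert (ht1 := HL (z * t)%C 0 zt ltac:(rewrite Cmod_0; exact hd2)).
  rewrite g0 in ht1. replace (z * t - 0)%C with (z * t)%C in ht1 by ring.
  replace (z * s - z * t)%C with (z * (s - t))%C in hst by ring. rewrite Cmod_mult in hst, ht1.
  assert (hp := H1 s t ltac:(lra) ltac:(lra)). cbv beta in hp.
  pose proof (Cmod_ge_0 (s - t)) as st0. set (X := Cmod (s - t)) in *.
  assert (hp2 : Cmod (s ^ k - t ^ k) <= (Cmod l + e / 3) * X).
  { replace (s ^ k - t ^ k)%C with ((s ^ k - t ^ k - (s - t) * l) + (s - t) * l)%C by ring.
    eapply Rle_trans; [apply Cmod_triangle|]. rewrite (Cmod_mult (s - t)). fold X. lra. }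
  unfold blowup.
  replace (s ^ k * g (z * s) - t ^ k * g (z * t) - (s - t) * l)%C
    with (s ^ k * (g (z * s) - g (z * t)) + (g (z * t) - 1) * (s ^ k - t ^ k)
          + (s ^ k - t ^ k - (s - t) * l))%C by ring.
  eapply Rle_trans; [apply Cmod_triangle|].
  eapply Rle_trans; [apply Rplus_le_compat_r, Cmod_triangle|].
  rewrite (Cmod_mult (s ^ k)), (Cmod_mult (g (z * t) - 1)%C), Cmod_pow.
  assert (Q1 : Cmod s ^ k * Cmod (g (z * s) - g (z * t))%C <= A ^ k * (L * (d * X))).
  { apply Rmult_le_compat; [now apply pow_le|apply Cmod_ge_0|apply pow_incr; lra|].
    eapply Rle_trans; [exact hst|]. apply Rmult_le_compat_l; [lra|]. apply Rmult_le_compat_r; lra. }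
  assert (Q2 : Cmod (g (z * t) - 1)%C * Cmod (s ^ k - t ^ k) <= (L * (d * A)) * ((Cmod l + e / 3) * X)).
  { apply Rmult_le_compat; [apply Cmod_ge_0|apply Cmod_ge_0| |exact hp2].
    eapply Rle_trans; [exact ht1|]. apply Rmult_le_compat_l; [lra|]. apply Rmult_le_compat; lra. }
  assert (Q3 : A ^ k * (L * (d * X)) + (L * (d * A)) * ((Cmod l + e / 3) * X) <= d * B * X).
  { replace (A ^ k * (L * (d * X)) + (L * (d * A)) * ((Cmod l + e / 3) * X))
      with (d * (A ^ k * L + L * A * (Cmod l + e / 3)) * X) by ring.
    apply Rmult_le_compat_r; [exact st0|]. apply Rmult_le_compat_l; [lra|]. unfold B; lra. }
  assert (Q4 : d * B * X <= e / 3 * X) by (apply Rmult_le_compat_r; lra).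
  assert (0 <= e / 3 * X) by (apply Rmult_le_pos; lra).
  lra.
Qed.

(** With error |l| / 2, the first inequality makes the Newton map with fixed slope l contract by
    1/2; the second is quantitative injectivity. *)
Lemma blowup_expanding (k : nat) (g : C -> C) (a l : C) :
  centire g -> g 0 = 1 -> l = (RtoC (INR k) * a ^ (k - 1))%C -> l <> 0 ->
  exists d, 0 < d /\ forall z s t, Cmod z < d -> Cmod (s - a) < d -> Cmod (t - a) < d ->
    Cmod (blowup k g z s - blowup k g z t - (s - t) * l) <= Cmod l / 2 * Cmod (s - t) /\
    Cmod l / 2 * Cmod (s - t) <= Cmod (blowup k g z s - blowup k g z t).
Proof.
  intros Hg g0 El hl. apply Cmod_gt_0 in hl.
  destruct (blowup_strict k g a (Cmod l / 2) Hg g0 ltac:(lra)) as [d [hd Hd]].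
  exists d. split; [exact hd|]. intros z s t hz hs ht. specialize (Hd z s t hz hs ht).
  rewrite <- El in Hd. split; [exact Hd|].
  set (D := (blowup k g z s - blowup k g z t)%C) in *.
  assert (h := Cmod_triangle_rev ((s - t) * l) ((s - t) * l - D)).
  replace ((s - t) * l - ((s - t) * l - D))%C with D in h by ring.
  rewrite (Cmod_minus_comm ((s - t) * l) D) in h. rewrite (Cmod_mult (s - t)) in h. lra.
Qed.

(** The steps from a sum to at most 2 |T a - a|, so the iterates stay where T contracts; the factor
    4 is that of [geometric_steps_limit]. The distance bound later shows that s tends to a. *)
Lemma contraction_fixpoint (T : C -> C) (a : C) (d : R) :
  (forall s t, Cmod (s - a) <= d -> Cmod (t - a) <= d -> Cmod (T s - T t) <= 1 / 2 * Cmod (s - t)) ->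
  4 * Cmod (T a - a) <= d ->
  exists s, T s = s /\ Cmod (s - a) <= 4 * Cmod (T a - a).
Proof.
  intros HT hd. set (m := Cmod (T a - a)) in *. assert (hm : 0 <= m) by apply Cmod_ge_0.
  set (x := fix x n := match n with O => a | S n => T (x n) end).
  assert (hp : forall n, 0 < (1 / 2) ^ n) by (intros n; apply pow_lt; lra).
  assert (hx : forall n, Cmod (x n - a) <= 2 * m * (1 - (1 / 2) ^ n) /\
    Cmod (x (S n) - x n) <= m * (1 / 2) ^ n).
  { induction n as [|n [h1 h2]].
    - simpl. rewrite Cmod_minus_diag. fold m. lra.
    - assert (hpn := hp n).
      assert (h3 : Cmod (x (S n) - a) <= 2 * m * (1 - (1 / 2) ^ S n)).
      { eapply Rle_trans; [apply (Cmod_minus_trans _ (x n))|]. simpl pow. lra. }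
      assert (0 <= m * (1 / 2) ^ n) by (apply Rmult_le_pos; lra).
      assert (0 <= m * (1 / 2) ^ S n) by (apply Rmult_le_pos; [lra|apply Rlt_le, hp]).
      split; [exact h3|].
      change (x (S (S n))) with (T (x (S n))). change (x (S n)) with (T (x n)) at 2.
      eapply Rle_trans; [apply HT; lra|]. simpl pow. lra. }
  destruct (geometric_steps_limit x m) as [p Hp]; [intros n; apply hx|].
  assert (hpa : Cmod (p - a) <= 4 * m).
  { specialize (Hp O). simpl in Hp. rewrite Cmod_minus_comm in Hp. lra. }
  exists p. split; [|exact hpa].
  assert (E : (T p - p)%C = 0).
  { apply Cmod_small_eq_0. intros e he.
    destruct (pow_lt_1_zero (1 / 2)) with (y := e / (4 * m + 1)) as [N HN].
    { rewrite Rabs_pos_eq; lra. }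
    { apply Rdiv_lt_0_compat; lra. }
    specialize (HN N (Nat.le_refl N)). assert (hN := hp N). rewrite Rabs_pos_eq in HN by lra.
    destruct (hx N) as [h1 _]. assert (h2 := Hp N). assert (h3 := Hp (S N)).
    change (x (S N)) with (T (x N)) in h3.
    assert (0 <= m * (1 / 2) ^ N) by (apply Rmult_le_pos; lra).
    assert (h4 := HT p (x N) ltac:(lra) ltac:(lra)).
    rewrite (Cmod_minus_comm p) in h4.
    assert (h5 := Cmod_minus_trans (T p) (T (x N)) p).
    simpl pow in h3.
    assert (h6 : (4 * m + 1) * (1 / 2) ^ N <= e).
    { apply Rle_trans with ((4 * m + 1) * (e / (4 * m + 1))); [|right; field; lra].
      apply Rmult_le_compat_l; lra. }
    lra. }
  replace (T p) with ((T p - p) + p)%C by ring. rewrite E. ring.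
Qed.

Lemma cderiv_neq_0_of_expanding (h : C -> C) (b m : C) (K : R) : 0 < K ->
  cnbhd b (fun x => K * Cmod (x - b) <= Cmod (h x - h b)) -> cderiv h b m -> m <> 0.
Proof.
  intros hK [d [hd Hd]] Hm E. rewrite E in Hm. rewrite cderiv_eps in Hm.
  destruct (Hm (K / 2) ltac:(lra)) as [d' [hd' Hd']].
  set (r := Rmin d d' / 2). assert (hr := Rmin_pos d d' hd hd').
  pose proof (Rmin_l d d'). pose proof (Rmin_r d d').
  assert (Er : (b + RtoC r - b)%C = RtoC r) by ring.
  assert (Em : Cmod (b + RtoC r - b) = r) by (rewrite Er, Cmod_R, Rabs_pos_eq; unfold r; lra).
  specialize (Hd (b + RtoC r)%C). specialize (Hd' (b + RtoC r)%C).
  rewrite Em in Hd, Hd'. specialize (Hd ltac:(unfold r; lra)). specialize (Hd' ltac:(unfold r; lra)).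
  replace (h (b + RtoC r) - h b - (b + RtoC r - b) * 0)%C with (h (b + RtoC r) - h b)%C in Hd' by ring.
  assert (0 < r) by (unfold r; lra). nra.
Qed.

(** Expansion of h gives h' <> 0, and the bound on phi gives its continuity, which is not
    presupposed. The slope of phi is then the slope of F divided by that of h along phi. *)
Lemma cderiv_of_lift (h F phi : C -> C) (u m q : C) (K : R) : 0 < K ->
  cnbhd (phi u) (fun x => K * Cmod (x - phi u) <= Cmod (h x - h (phi u))) ->
  cnbhd u (fun v => K * Cmod (phi v - phi u) <= Cmod (F v - F u)) ->
  cnbhd u (fun v => h (phi v) = F v) ->
  cderiv h (phi u) m -> cderiv F u q -> cderiv phi u (q / m)%C.
Proof.
  intros hK He Hl Heq Hh HF.
  assert (hm := cderiv_neq_0_of_expanding h (phi u) m K hK He Hh).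
  assert (Hphi : clim (cnbhd u) phi (phi u)).
  { intros e he. assert (he' : 0 < K * e) by now apply Rmult_lt_0_compat.
    generalize (filter_and _ _ Hl (cderiv_cont _ _ _ HF _ he')). apply filter_imp.
    intros v [h1 h2]. apply Rmult_lt_reg_l with K; [exact hK|lra]. }
  assert (Eu : h (phi u) = F u).
  { destruct Heq as [d [hd H]]. apply H. rewrite Cmod_minus_diag; lra. }
  destruct Hh as [Q [EQ [Qm HQ]]]. destruct HF as [P [EP [Pq HP]]].
  assert (HQp : clim (cnbhd u) (fun v => Q (phi v)) m) by (now apply (clim_comp _ phi Q (phi u))).
  apply (cderiv_intro _ (fun v => P v / Q (phi v))%C).
  - assert (hm' := hm). apply Cmod_gt_0 in hm'.
    generalize (filter_and _ _ Heq (HQp _ hm')). apply filter_imp. intros v [h1 h2].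
    assert (hQ : Q (phi v) <> 0).
    { intros E. rewrite E in h2. replace (0 - m)%C with (- m)%C in h2 by ring.
      rewrite Cmod_opp in h2. lra. }
    rewrite (EQ (phi v)), (EP v), Eu in h1.
    replace (phi v) with (phi u + ((F u + (phi v - phi u) * Q (phi v)) - F u) / Q (phi v))%C at 1
      by now field.
    rewrite h1. now field.
  - apply clim_div; auto; apply _.
Qed.

(** The branch is u s(u), where s(u) near a solves [blowup k g u s = g u]. At u = 0 its slope is
    s(u), which tends to a. At u <> 0 it is a local lift of f through f, and rescaling by u supplies
    the expansion that [cderiv_of_lift] asks for. *)
Lemma rotated_branch (f : C -> C) (w : C) (k : nat) (c : C) (g : C -> C) (a : C) :
  centire f -> (1 <= k)%nat -> c <> 0 -> centire g -> g 0 = 1 ->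
  (forall u, f (w + u)%C = (f w + c * (u ^ k * g u))%C) ->
  (a ^ k)%C = 1 -> Cmod a = 1 ->
  exists (r : R) (phi : C -> C), 0 < r /\ phi 0 = 0 /\ cderiv phi 0 a /\
    forall u, Cmod u < r -> (exists l, cderiv phi u l) /\ f (w + phi u)%C = f (w + u)%C.
Proof.
  intros Hf hk hc Hg g0 Ef ak am.
  set (l := (RtoC (INR k) * a ^ (k - 1))%C).
  assert (ha : a <> 0) by (apply Cmod_gt_0; lra).
  assert (hl : l <> 0).
  { apply Cmult_neq_0; [|now apply Cpow_nz]. apply RtoC_neq_0. apply not_0_INR. lia. }
  assert (hl' := hl). apply Cmod_gt_0 in hl'.
  destruct (blowup_expanding k g a l Hg g0 eq_refl hl) as [d0 [hd0 Hd0]].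
  set (d := Rmin d0 1).
  assert (hd : 0 < d) by (apply Rmin_pos; lra).
  assert (dd0 : d <= d0) by apply Rmin_l. assert (d1 : d <= 1) by apply Rmin_r.
  assert (Hgc := centire_cont g Hg).
  (* With g u and g (u a) both this close to 1, 4 |g (u a) - g u| / |l| is at most 4 (d / 8) = d /
     2, the radius of the contraction. *)
  assert (hdl : 0 < Cmod l * d / 16) by (assert (0 < Cmod l * d) by (now apply Rmult_lt_0_compat); lra).
  destruct (Hgc 0 _ hdl) as [r0 [hr0 Hr0]]. rewrite g0 in Hr0.
  set (r := Rmin d r0). assert (hr : 0 < r) by now apply Rmin_pos.
  assert (rd : r <= d) by apply Rmin_l. assert (rr0 : r <= r0) by apply Rmin_r.
  assert (Hs : forall u, exists s, Cmod u < r ->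
    blowup k g u s = g u /\ Cmod (s - a) <= 4 * (Cmod (g (u * a)%C - g u) / Cmod l) /\ Cmod (s - a) <= d / 2).
  { intros u. destruct (Rlt_dec (Cmod u) r) as [hu|hu]; [|exists 0; tauto].
    (* Newton's map with the slope frozen at l. Since a^k = 1, its first step has length |g (u a) -
       g u| / |l|. *)
    set (T := fun s => (s - (blowup k g u s - g u) / l)%C).
    assert (ET : Cmod (T a - a) = Cmod (g (u * a)%C - g u) / Cmod l).
    { rewrite <- Cmod_div by exact hl. rewrite <- Cmod_opp. f_equal. unfold T, blowup.
      rewrite ak. now field. }
    assert (hT : 4 * Cmod (T a - a) <= d / 2).
    { rewrite ET.
      assert (h1 := Hr0 (u * a)%C). assert (h2 := Hr0 u).
      replace (u * a - 0)%C with (u * a)%C in h1 by ring. replace (u - 0)%C with u in h2 by ring.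
      rewrite Cmod_mult, am in h1. specialize (h1 ltac:(lra)). specialize (h2 ltac:(lra)).
      assert (h3 := Cmod_minus_trans (g (u * a)%C) 1 (g u)). rewrite (Cmod_minus_comm 1) in h3.
      apply Rle_trans with (4 * (Cmod l * d / 8 / Cmod l)); [|right; field; lra].
      apply Rmult_le_compat_l; [lra|]. apply Rmult_le_compat_r; [|lra].
      apply Rlt_le, Rinv_0_lt_compat; lra. }
    destruct (contraction_fixpoint T a (d / 2)) as [s [Es h]]; [|exact hT|].
    - intros s t h1 h2.
      destruct (Hd0 u s t ltac:(lra) ltac:(lra) ltac:(lra)) as [h3 _].
      unfold T.
      replace (s - (blowup k g u s - g u) / l - (t - (blowup k g u t - g u) / l))%C
        with (- ((blowup k g u s - blowup k g u t - (s - t) * l) / l))%C by now field.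
      rewrite Cmod_opp, Cmod_div by exact hl.
      apply Rmult_le_reg_r with (Cmod l); [exact hl'|].
      unfold Rdiv at 1. rewrite Rmult_assoc, Rinv_l by lra. lra.
    - exists s. intros _. rewrite ET in h, hT. split; [|lra].
      unfold T in Es.
      replace (blowup k g u s) with (g u + (s - (s - (blowup k g u s - g u) / l)) * l)%C by now field.
      rewrite Es. ring. }
  set (s := fun u => proj1_sig (constructive_indefinite_description _ (Hs u))).
  assert (Hs' : forall u, Cmod u < r ->
    blowup k g u (s u) = g u /\ Cmod (s u - a) <= 4 * (Cmod (g (u * a)%C - g u) / Cmod l) /\ Cmod (s u - a) <= d / 2).
  { intros u. unfold s. now destruct constructive_indefinite_description. }
  clearbody s.
  assert (Hphi : forall u, Cmod u < r -> f (w + u * s u)%C = f (w + u)%C).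
  { intros u hu. destruct (Hs' u hu) as [E _]. rewrite !Ef, <- E. unfold blowup.
    rewrite Cpow_mult_l. ring. }
  assert (Hphi0 : cderiv (fun u => u * s u)%C 0 a).
  { apply (cderiv_intro _ s).
    - apply filter_forall. intros y. ring.
    - intros e he.
      assert (H : clim (cnbhd 0) (fun u => g (u * a) - g u)%C 0).
      { apply (clim_val _ _ (g 0 - g 0)%C); [ring|]. apply clim_minus; [apply _| |apply Hgc].
        apply (clim_comp _ (fun u => u * a)%C g 0); [|apply Hgc].
        apply (clim_val _ _ (0 * a)%C); [ring|]. apply clim_mult; [apply _|apply clim_id|apply clim_const, _]. }
      assert (he' : 0 < e * Cmod l / 4) by (assert (0 < e * Cmod l) by (now apply Rmult_lt_0_compat); lra).
      assert (Hr : cnbhd 0 (fun u => Cmod u < r)).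
      { exists r. split; [exact hr|]. intros y hy. now replace (y - 0)%C with y in hy by ring. }
      generalize (filter_and _ _ Hr (H _ he')). apply filter_imp. intros u [hu h].
      destruct (Hs' u hu) as [_ [h1 _]]. eapply Rle_lt_trans; [exact h1|].
      replace (g (u * a) - g u - 0)%C with (g (u * a) - g u)%C in h by ring.
      apply Rmult_lt_reg_r with (Cmod l / 4); [lra|].
      replace (4 * (Cmod (g (u * a) - g u)%C / Cmod l) * (Cmod l / 4)) with (Cmod (g (u * a) - g u)%C) by (field; lra).
      lra. }
  exists r, (fun u => u * s u)%C. split; [exact hr|]. split; [ring|]. split; [exact Hphi0|].
  intros u hu. split; [|now apply Hphi].
  destruct (excluded_middle_informative (u = 0)) as [->|nu]; [now exists a|].
  assert (hu0 := nu). apply Cmod_gt_0 in hu0.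
  assert (hc' := hc). apply Cmod_gt_0 in hc'.
  (* Points x near u or near its image are all rescaled by the same fixed u: f (w + x) - f (w + y)
     is c u^k times a difference of blow-ups at x / u and y / u, which expands by |l| / 2. *)
  set (K := Cmod c * Cmod u ^ k * (Cmod l / 2) / Cmod u).
  assert (hK : 0 < K).
  { apply Rdiv_lt_0_compat; [|exact hu0].
    apply Rmult_lt_0_compat; [|lra]. apply Rmult_lt_0_compat; [exact hc'|]. now apply pow_lt. }
  assert (Hexp : forall x y, Cmod (x / u - a) < d -> Cmod (y / u - a) < d ->
    K * Cmod (x - y) <= Cmod (f (w + x)%C - f (w + y)%C)).
  { intros x y hx hy.
    destruct (Hd0 u (x / u)%C (y / u)%C ltac:(lra) ltac:(lra) ltac:(lra)) as [_ h].
    replace (f (w + x) - f (w + y))%C with (c * u ^ k * (blowup k g u (x / u) - blowup k g u (y / u)))%C.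
    2:{ rewrite !Ef. unfold blowup.
        replace (u * (x / u))%C with x by now field. replace (u * (y / u))%C with y by now field.
        replace (c * (x ^ k * g x))%C with (c * ((u * (x / u)) ^ k * g x))%C
          by (now replace (u * (x / u))%C with x by now field).
        replace (c * (y ^ k * g y))%C with (c * ((u * (y / u)) ^ k * g y))%C
          by (now replace (u * (y / u))%C with y by now field).
        rewrite !Cpow_mult_l. ring. }
    rewrite (Cmod_mult (c * u ^ k)), (Cmod_mult c), Cmod_pow.
    replace (K * Cmod (x - y)) with (Cmod c * Cmod u ^ k * (Cmod l / 2 * Cmod (x / u - y / u))).
    2:{ replace (x / u - y / u)%C with ((x - y) / u)%C by now field.
        rewrite Cmod_div by exact nu. unfold K. field. lra. }
    apply Rmult_le_compat_l; [|exact h].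
    apply Rmult_le_pos; [lra|]. apply pow_le; lra. }
  assert (Hu : Cmod (u * s u / u - a) <= d / 2).
  { replace (u * s u / u)%C with (s u) by now field. now apply Hs'. }
  destruct (Hf (w + u * s u)%C) as [m Hm]. destruct (Hf (w + u)%C) as [q Hq].
  exists (q / m)%C.
  apply (cderiv_of_lift (fun x => f (w + x)%C) (fun x => f (w + x)%C) _ u m q K hK).
  - exists (Cmod u * d / 2). split; [assert (0 < Cmod u * d) by (now apply Rmult_lt_0_compat); lra|].
    intros x hx. apply Hexp; [|lra].
    replace (x / u - a)%C with ((x - u * s u) / u + (u * s u / u - a))%C by now field.
    eapply Rle_lt_trans; [apply Cmod_triangle|]. rewrite Cmod_div by exact nu.
    assert (Cmod (x - u * s u) / Cmod u < d / 2); [|lra].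
    apply Rmult_lt_reg_r with (Cmod u); [exact hu0|].
    unfold Rdiv at 1. rewrite Rmult_assoc, Rinv_l by lra. lra.
  (* As |s v| <= 3/2, this radius keeps v (s v) / u within (d / 4) (3 / 2) + d / 2 < d of a. *)
  - exists (Rmin (r - Cmod u) (Cmod u * d / 4)).
    split; [apply Rmin_pos; [lra|assert (0 < Cmod u * d) by (now apply Rmult_lt_0_compat); lra]|].
    intros v hv. pose proof (Rmin_l (r - Cmod u) (Cmod u * d / 4)). pose proof (Rmin_r (r - Cmod u) (Cmod u * d / 4)).
    assert (hvr : Cmod v < r).
    { assert (h := Cmod_triangle (v - u) u). replace (v - u + u)%C with v in h by ring. lra. }
    rewrite <- (Hphi u hu), <- (Hphi v hvr). apply Hexp; [|lra].
    destruct (Hs' v hvr) as [_ [_ hs]].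
    assert (bs : Cmod (s v) <= 3 / 2).
    { assert (h := Cmod_triangle (s v - a) a). replace (s v - a + a)%C with (s v) in h by ring. lra. }
    replace (v * s v / u - a)%C with ((v - u) / u * s v + (s v - a))%C by now field.
    eapply Rle_lt_trans; [apply Cmod_triangle|]. rewrite Cmod_mult, Cmod_div by exact nu.
    assert (hvu : Cmod (v - u) / Cmod u < d / 4).
    { apply Rmult_lt_reg_r with (Cmod u); [exact hu0|].
      unfold Rdiv at 1. rewrite Rmult_assoc, Rinv_l by lra. lra. }
    assert (Cmod (v - u) / Cmod u * Cmod (s v) <= d / 4 * (3 / 2)).
    { apply Rmult_le_compat; try lra; [|apply Cmod_ge_0].
      apply Rmult_le_pos; [apply Cmod_ge_0|]. apply Rlt_le, Rinv_0_lt_compat; lra. }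
    lra.
  - exists (r - Cmod u). split; [lra|]. intros v hv. apply Hphi.
    assert (h := Cmod_triangle (v - u) u). replace (v - u + u)%C with v in h by ring. lra.
  - now apply cderiv_translate.
  - now apply cderiv_translate.
Qed.

(** If a = 1, the slope q y of phi is close to 1 and solves the same blown-up equation as s = 1, so
    injectivity forces q y = 1. If a <> 1, phi y - y behaves like (a - 1) (y - z), whose zero is
    isolated. *)
Lemma fixed_branch_dichotomy (f phi : C -> C) (z : C) (a : C) :
  centire f -> nonconstant f -> cderiv phi z a -> phi z = z ->
  cnbhd z (fun y => f (phi y) = f y) ->
  cnbhd z (fun y => phi y = y) \/ cnbhd z (fun y => y <> z -> phi y <> y).
Proof.
  intros Hf Hnc Hphi Ez Hfp.
  destruct (excluded_middle_informative (a = 1)) as [->|na].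
  - left. destruct (centire_normal_form f z Hf Hnc) as [k [c [g [hk [hc [Hg [g0 Ef]]]]]]].
    assert (hl : (RtoC (INR k) * 1 ^ (k - 1))%C <> 0).
    { rewrite Cpow_1_l. apply Cmult_neq_0; [|apply RtoC_neq_0; lra]. apply RtoC_neq_0, not_0_INR. lia. }
    destruct (blowup_expanding k g 1 _ Hg g0 eq_refl hl) as [d [hd Hd]].
    apply Cmod_gt_0 in hl.
    destruct Hphi as [q [Eq [_ Hq]]].
    assert (Hb : cnbhd z (fun y => Cmod (y - z) < d)) by (exists d; auto).
    generalize (filter_and _ _ Hfp (filter_and _ _ Hb (Hq d hd))). apply filter_imp.
    intros y [h1 [h2 h3]].
    destruct (excluded_middle_informative (y = z)) as [->|ny]; [exact Ez|].
    set (u := (y - z)%C) in *.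
    assert (nu : u <> 0) by (apply Cmod_gt_0; now apply Cmod_minus_neq_0).
    assert (Ep : phi y = (z + u * q y)%C) by (rewrite (Eq y), Ez; reflexivity).
    assert (Ey : y = (z + u)%C) by (unfold u; ring).
    rewrite Ep in h1. rewrite Ey in h1 at 2. rewrite !Ef, Cpow_mult_l in h1.
    assert (hcu : (c * u ^ k)%C <> 0) by (apply Cmult_neq_0; [exact hc|now apply Cpow_nz]).
    assert (E : blowup k g u (q y) = blowup k g u 1).
    { unfold blowup. rewrite Cpow_1_l. replace (u * 1)%C with u by ring.
      replace (q y ^ k * g (u * q y))%C
        with ((f z + c * (u ^ k * q y ^ k * g (u * q y)) - f z) / (c * u ^ k))%C.
      - rewrite h1. field. split; [now apply Cpow_nz|exact hc].
      - field. split; [now apply Cpow_nz|exact hc]. }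
    destruct (Hd u (q y) 1 h2 h3) as [_ h4]; [rewrite Cmod_minus_diag; lra|].
    rewrite E, Cmod_minus_diag in h4.
    assert (Cmod (q y - 1) <= 0) by nra.
    assert (Eq1 : (q y - 1)%C = 0) by (apply Cmod_eq_0; pose proof (Cmod_ge_0 (q y - 1)); lra).
    rewrite Ep. replace (q y) with ((q y - 1) + 1)%C by ring. rewrite Eq1. unfold u. ring.
  - right. apply Cmod_minus_neq_0 in na. rewrite cderiv_eps in Hphi.
    destruct (Hphi (Cmod (a - 1) / 2) ltac:(lra)) as [d [hd Hd]].
    exists d. split; [exact hd|]. intros y hy ny E. specialize (Hd y hy).
    rewrite E, Ez in Hd. apply Cmod_minus_neq_0 in ny.
    replace (y - z - (y - z) * a)%C with (- ((a - 1) * (y - z)))%C in Hd by ring.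
    rewrite Cmod_opp, Cmod_mult in Hd. nra.
Qed.

(** * Roots of unity and connectedness of discs *)

Lemma Cpow_cos_sin (t : R) (n : nat) : ((cos t, sin t) ^ n)%C = (cos (INR n * t), sin (INR n * t)).
Proof.
  induction n as [|n IH].
  - simpl INR. rewrite Rmult_0_l, cos_0, sin_0. reflexivity.
  - rewrite Cpow_S, IH, S_INR. replace ((INR n + 1) * t) with (INR n * t + t) by ring.
    rewrite cos_plus, sin_plus. unfold Cmult; simpl. f_equal; ring.
Qed.

Lemma nontrivial_root_of_unity (k : nat) : (2 <= k)%nat ->
  exists a : C, (a ^ k)%C = 1 /\ Cmod a = 1 /\ a <> 1.
Proof.
  intros hk. set (t := 2 * PI / INR k). pose proof PI_RGT_0 as hpi.
  assert (hk' : 2 <= INR k) by (apply (le_INR 2) in hk; simpl in hk; lra).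
  assert (Et : INR k * t = 2 * PI) by (unfold t; field; lra).
  assert (ht : 0 < t) by (apply Rdiv_lt_0_compat; lra).
  (* Here k >= 2 enters: the cosine decreases strictly on [0, PI], so cos t < 1. *)
  assert (ht2 : t <= PI) by nra.
  exists (cos t, sin t). split; [|split].
  - rewrite Cpow_cos_sin, Et, cos_2PI, sin_2PI. reflexivity.
  - assert (h := Cmod_circ 1 t Rle_0_1). unfold circ in h.
    now rewrite Cmult_1_l in h.
  - intros E. injection E as E1 E2.
    assert (h := cos_decreasing_1 0 t). rewrite cos_0 in h. lra.
Qed.

(** By convexity a separation restricts to a segment, where it would give a real function with zero
    derivative taking the values 1 and 0. *)
Lemma connected_disc (w : C) (r : R) : connected_set (fun z => Cmod (z - w) < r).
Proof.
  intros A B HA HB Hcov Hdis [a [ha Aa]] [b [hb Bb]].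
  set (p := fun t => (a + RtoC t * (b - a))%C).
  assert (Hp : rcont p) by (exact (rcont_segment (fun y => y) a b (fun z => clim_id z))).
  assert (Hin : forall t, 0 <= t <= 1 -> Cmod (p t - w) < r).
  { intros t ht. replace (p t - w)%C with (RtoC (1 - t) * (a - w) + RtoC t * (b - w))%C
      by (unfold p; rewrite RtoC_minus; ring).
    eapply Rle_lt_trans; [apply Cmod_triangle|]. rewrite !Cmod_mult, !Cmod_R, !Rabs_pos_eq by lra.
    pose proof (Rmax_l (Cmod (a - w)) (Cmod (b - w))). pose proof (Rmax_r (Cmod (a - w)) (Cmod (b - w))).
    assert (Rmax (Cmod (a - w)) (Cmod (b - w)) < r) by now apply Rmax_lub_lt. nra. }
  assert (Hdisc : open (fun z => Cmod (z - w) < r)).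
  { intros z hz. apply cnbhd_locally. exists (r - Cmod (z - w)). split; [lra|]. intros y hy.
    assert (h := Cmod_minus_trans y z w). lra. }
  (* The indicator function of A along the segment is locally constant. *)
  set (chi := fun t => if excluded_middle_informative (A (p t)) then 1 else 0).
  assert (Hloc : forall (U : C -> Prop) t, open U -> U (p t) -> locally t (fun s => U (p s))).
  { intros U t HU h. apply HU, cnbhd_locally in h. destruct h as [d [hd Hd]].
    generalize (Hp t d hd). apply filter_imp. intros s hs. now apply Hd. }
  assert (E : chi 0 = chi 1).
  { apply (eq_is_derive (V := R_NormedModule)); [|lra]. intros t ht.
    apply is_derive_ext_loc with (f := fun _ => chi t); [|apply (is_derive_const (V := R_NormedModule))].
    destruct (Hcov _ (Hin t ht)) as [h|h].
    - generalize (Hloc A t HA h). apply filter_imp. intros s hs. unfold chi.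
      destruct excluded_middle_informative; [|tauto]. destruct excluded_middle_informative; tauto.
    - generalize (filter_and _ _ (Hloc _ t Hdisc (Hin t ht)) (Hloc B t HB h)). apply filter_imp.
      intros s [h1 h2]. unfold chi.
      destruct excluded_middle_informative as [h3|h3]; [exfalso; exact (Hdis _ (Hin t ht) h3 h)|].
      destruct excluded_middle_informative as [h4|h4]; [exfalso; exact (Hdis _ h1 h4 h2)|reflexivity]. }
  unfold chi in E.
  replace (p 0) with a in E by (unfold p; ring). replace (p 1) with b in E by (unfold p; ring).
  destruct excluded_middle_informative as [h|h]; [|tauto].
  destruct excluded_middle_informative as [h'|h']; [|lra].
  exact (Hdis b hb h' Bb).
Qed.

(** * The two inclusions between critical points and fixed points *)

Lemma entire_centire (f : C -> C) : entire f -> centire f.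
Proof. intros H z. destruct (H z) as [l Hl]. exists l. now apply cderiv_is_derive. Qed.

Lemma critical_point_FixAut (f : C -> C) (w : C) :
  centire f -> nonconstant f -> cderiv f w 0 -> FixAut f w.
Proof.
  intros Hf Hnc Hw.
  destruct (centire_normal_form f w Hf Hnc) as [k [c [g [hk [hc [Hg [g0 Ef]]]]]]].
  (* For k = 1 the normal form gives f' w = c, which is nonzero. *)
  assert (hk2 : (2 <= k)%nat).
  { destruct (Nat.eq_dec k 1) as [->|]; [|lia]. exfalso. apply hc.
    apply (cderiv_unique (fun u => f (w + u)%C) 0).
    - apply (cderiv_intro _ (fun u => c * g u)%C).
      + apply filter_forall. intros u. rewrite (Ef u).
        replace (w + 0)%C with w by ring. simpl. ring.
      + apply (clim_val _ _ (c * g 0)%C); [rewrite g0; ring|].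
        apply clim_mult; [apply _|apply clim_const, _|now apply centire_cont].
    - apply cderiv_translate. now replace (w + 0)%C with w by ring. }
  destruct (nontrivial_root_of_unity k hk2) as [a [ak [am na]]].
  destruct (rotated_branch f w k c g a Hf hk hc Hg g0 Ef ak am) as [r [phi [hr [phi0 [Hphi0 Hphi]]]]].
  exists (fun z => Cmod (z - w) < r), (fun z => w + phi (z - w))%C.
  assert (Hd : forall z m, cderiv phi (z - w)%C m -> cderiv (fun z => w + phi (z - w))%C z m).
  { intros z m Hm. apply (cderiv_val _ _ (0 + (1 - 0) * m)%C); [ring|].
    apply (cderiv_plus (fun _ => w) (fun z => phi (z - w))%C); [apply cderiv_const|].
    apply (cderiv_comp phi (fun z => z - w)%C); [exact Hm|].
    apply cderiv_minus; [apply cderiv_id|apply cderiv_const]. }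
  split; [split|split].
  - split; [|split; [apply connected_disc|]].
    + intros z hz. apply cnbhd_locally. exists (r - Cmod (z - w)). split; [lra|]. intros y hy.
      assert (h := Cmod_minus_trans y z w). lra.
    + exists w. rewrite Cmod_minus_diag; exact hr.
  - intros z hz. destruct (Hphi _ hz) as [[m Hm] E]. split.
    + exists m. apply cderiv_is_derive. now apply Hd.
    + rewrite E. f_equal. ring.
  (* If the branch were the identity on the disc, its derivative at w would be 1 and not a. *)
  - apply NNPP. intros hn. apply na. apply (cderiv_unique phi 0 _ _ Hphi0).
    apply (cderiv_ext_loc (fun u => u)); [|apply cderiv_id].
    exists r. split; [exact hr|]. intros u hu. replace (u - 0)%C with u in hu by ring.
    apply NNPP. intros hu'. apply hn. exists (w + u)%C.
    replace (w + u - w)%C with u by ring. split; [exact hu|].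
    intros E. apply hu'. replace u with ((w + u) - w)%C at 1 by ring. rewrite <- E. ring.
  - split.
    + intros e. exists w. rewrite Cmod_minus_diag. split; [exact hr|apply ball_center].
    + assert (Hc : clim (cnbhd w) (fun z => w + phi (z - w))%C w).
      { apply (clim_val _ _ (w + phi (w - w))%C).
        - replace (w - w)%C with (RtoC 0) by ring. rewrite phi0. ring.
        - apply (cderiv_cont (fun z => w + phi (z - w))%C w a). apply Hd.
          now replace (w - w)%C with (RtoC 0) by ring. }
      intros P HP. apply cnbhd_locally in HP. destruct HP as [e [he He]].
      apply cnbhd_locally. generalize (Hc e he). apply filter_imp. intros z hz _. now apply He.
Qed.

Lemma FixAut_critical_point (f : C -> C) (w : C) :
  centire f -> nonconstant f -> FixAut f w -> cderiv f w 0.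
Proof.
  intros Hf Hnc [U [phi [[[HU [Hconn _]] Hphi] [[z1 [Uz1 nz1]] [Hcl Hlim]]]]].
  destruct (Hf w) as [l Hl].
  destruct (excluded_middle_informative (l = 0)) as [El|nl]; [now rewrite <- El|exfalso].
  assert (HUn : forall z, U z -> cnbhd z U) by (intros z hz; now apply cnbhd_locally, HU).
  assert (Hd : forall z, U z -> exists m, cderiv phi z m).
  { intros z hz. destruct (Hphi z hz) as [[m Hm] _]. exists m. now apply cderiv_is_derive. }
  apply Cmod_gt_0 in nl.
  (* Two points near w with equal values of f satisfy |l| |x - y| <= (|l| / 2) |x - y|, so they
     coincide. *)
  destruct (centire_sderiv f w l Hf Hl (Cmod l / 2) ltac:(lra)) as [d [hd Hinj]].
  assert (Hw : cnbhd w (fun z => U z -> Cmod (phi z - w) < d)).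
  { apply cnbhd_locally. apply (Hlim (fun y => Cmod (y - w) < d)).
    apply cnbhd_locally. exists d; auto. }
  assert (Hid : cnbhd w (fun z => U z -> phi z = z)).
  { assert (Hb : cnbhd w (fun z => Cmod (z - w) < d)) by (exists d; auto).
    generalize (filter_and _ _ Hw Hb). apply filter_imp. intros z [h1 h2] hz.
    specialize (Hinj (phi z) z (h1 hz) h2). rewrite (proj2 (Hphi z hz)) in Hinj.
    replace (f z - f z - (phi z - z) * l)%C with (- ((phi z - z) * l))%C in Hinj by ring.
    rewrite Cmod_opp, Cmod_mult in Hinj. apply NNPP. intros n.
    apply Cmod_minus_neq_0 in n. nra. }
  (* U is split into the points near which phi is the identity and the rest; both sets are open and
     both meet U. *)
  apply (Hconn (fun z => cnbhd z (fun y => phi y = y)) (fun z => U z /\ ~ cnbhd z (fun y => phi y = y))).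
  - intros z [e [he He]]. apply cnbhd_locally. exists (e / 2). split; [lra|]. intros y hy.
    exists (e / 2). split; [lra|]. intros x hx. apply He.
    assert (h := Cmod_minus_trans x y z). lra.
  - intros z [hz hn]. apply cnbhd_locally.
    destruct (Hd z hz) as [m Hm].
    (* If phi z <> z, continuity excludes fixed points near z. If phi z = z, the dichotomy leaves
       only isolated fixed points, near none of which phi is the identity. *)
    assert (Hne : cnbhd z (fun y => ~ cnbhd y (fun x => phi x = x))).
    { assert (Hat : forall y, cnbhd y (fun x => phi x = x) -> phi y = y).
      { intros y [e [he He]]. apply He. rewrite Cmod_minus_diag; lra. }
      destruct (excluded_middle_informative (phi z = z)) as [Ez|nz].
      - destruct (fixed_branch_dichotomy f phi z m Hf Hnc Hm Ez) as [h|h]; [|tauto|].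
        + generalize (HUn z hz). apply filter_imp. intros y hy. now apply Hphi.
        + revert h. apply filter_imp. intros y hy hy'.
          destruct (excluded_middle_informative (y = z)) as [->|ny]; [tauto|].
          apply (hy ny). now apply Hat.
      - assert (Hc : clim (cnbhd z) (fun y => phi y - y)%C (phi z - z)%C).
        { apply clim_minus; [apply _|exact (cderiv_cont _ _ _ Hm)|apply clim_id]. }
        apply Cmod_minus_neq_0 in nz. generalize (Hc _ nz). apply filter_imp.
        intros y hy hy'. rewrite (Hat y hy') in hy.
        replace (y - y - (phi z - z))%C with (- (phi z - z))%C in hy by ring.
        rewrite Cmod_opp in hy. lra. }
    generalize (filter_and _ _ (HUn z hz) Hne). apply filter_imp. tauto.
  - intros z hz. destruct (classic (cnbhd z (fun y => phi y = y))); tauto.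
  - intros z _ h [_ h']. exact (h' h).
  (* The point w may lie outside U, so a point of U close to w is used. The radius e / 2 accounts
     for [ball] being a square. *)
  - destruct Hid as [e [he He]].
    assert (he2 : 0 < e / 2) by lra.
    destruct (Hcl (mkposreal _ he2)) as [z [hz [b1 b2]]].
    exists z. split; [exact hz|].
    assert (hzw : Cmod (z - w) < e).
    { eapply Rle_lt_trans; [apply Cmod_le_Re_Im|].
      change (Rabs (Re z - Re w) < e / 2) in b1. change (Rabs (Im z - Im w) < e / 2) in b2.
      change (Re (z - w)) with (Re z - Re w). change (Im (z - w)) with (Im z - Im w). lra. }
    assert (Hb : cnbhd z (fun y => Cmod (y - z) < e - Cmod (z - w))) by (exists (e - Cmod (z - w)); split; [lra|auto]).
    generalize (filter_and _ _ (HUn z hz) Hb). apply filter_imp. intros y [hy1 hy2].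
    apply He; [|exact hy1]. assert (h := Cmod_minus_trans y z w). lra.
  - exists z1. split; [exact Uz1|]. split; [exact Uz1|]. intros [e [he He]]. apply nz1.
    apply He. rewrite Cmod_minus_diag; exact he.
Qed.

Theorem theorem4 (f : C -> C) (hf : entire f) (hnc : nonconstant f) :
  forall w : C, C_is_derive f w 0 <-> FixAut f w.
Proof.
  intros w. apply entire_centire in hf. rewrite cderiv_is_derive. split.
  - now apply critical_point_FixAut.
  - now apply FixAut_critical_point.
Qed.
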